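(* \textsc{Min-Hurwicz}~$1|prec|\max w_jT_j$, i.e. the problem of minimizing $\alpha\max_{i\in[K]}f(\pi,S_i)+(1-\alpha)\min_{i\in[K]}f(\pi,S_i)$ over $\pi\in\Pi$ for a fixed $\alpha\in[0,1]$, is solvable in $O(K^2n^4)$ time.
   Context: Single machine scheduling under scenarios. A set of jobs $J=\{1,\dots,n\}$ must be processed nonpreemptively on one machine, all jobs being available at time $0$; jobs may be subject to precedence constraints given by a partial order ($i\rightarrow j$ means job $j$ cannot start before job $i$ is completed). A schedule is a permutation $\pi$ of $J$ respecting the precedence constraints; $\Pi$ denotes the set of all schedules. A scenario set $\Gamma=\{S_1,\dots,S_K\}$, $K>1$, is given (the number of scenarios is part of the input); under scenario $S_i$ job $j$ has a nonnegative processing time $p_j(S_i)$, nonnegative due date $d_j(S_i)$ and nonnegative weight $w_j(S_i)$. $C_j(\pi,S_i)$ is the completion time of $j$ in $\pi$ under $S_i$, i.e. the sum of $p_k(S_i)$ over $k=j$ and all jobs $k$ preceding $j$ in $\pi$. The cost of $\pi$ under $S_i$ is $f(\pi,S_i)=\max_{j\in J} w_j(S_i)[C_j(\pi,S_i)-d_j(S_i)]^+$, where $[x]^+=\max\{0,x\}$. *)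

(* Defs.v *)
From mathcomp Require Import all_boot all_order all_algebra.
Set Implicit Arguments. Unset Strict Implicit. Unset Printing Implicit Defensive.
Import Order.TTheory GRing.Theory Num.Theory.
Local Open Scope ring_scope.

(* p i j, d i j, w i j : processing time / due date / weight of job j   *)
(* under scenario S_i.  A schedule is a sequence of jobs.              *)

Section Sched.
Variable R : realFieldType.

Definition strict_partial_order (n : nat) (prec : nat -> nat -> bool) : Prop :=
  (forall j, (j < n)%N -> ~~ prec j j) /\
  (forall i j k, (i < n)%N -> (j < n)%N -> (k < n)%N ->
     prec i j -> prec j k -> prec i k).

Definition feasible (n : nat) (prec : nat -> nat -> bool) (s : seq nat) : Prop :=
  perm_eq s (iota 0 n) /\
  (forall i j, (i < n)%N -> (j < n)%N -> prec i j -> (index i s < index j s)%N).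

Definition completion (p : nat -> nat -> R) (s : seq nat) (i j : nat) : R :=
  \sum_(k <- take (index j s).+1 s) p i k.

Definition cost (p d w : nat -> nat -> R) (s : seq nat) (i : nat) : R :=
  \big[Num.max/0]_(j <- s) (w i j * Num.max 0 (completion p s i j - d i j)).

Definition hurwicz (K : nat) (alpha : R) (p d w : nat -> nat -> R)
    (s : seq nat) : R :=
  alpha * \big[Num.max/0]_(i < K) cost p d w s i
  + (1 - alpha) * \big[Num.min/cost p d w s 0]_(i < K) cost p d w s i.

End Sched.

(* Machine model for running time: a unit-cost real RAM.               *)
(* Registers and memory come in two sorts: natural numbers (indices,   *)
(* only + and truncated - , no multiplication) and reals (+, -, *,     *)
(* comparison).  Memories are two-dimensional (addressed by two nat    *)
(* registers).  Every executed instruction costs one time unit.        *)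

Inductive instr : Type :=
| NConst (dst k : nat)
| NAdd (dst a b : nat)
| NSub (dst a b : nat)
| NLoad (dst a b : nat)
| NStore (a b src : nat)
| RConst (dst k : nat)
| RAdd (dst a b : nat)
| RSub (dst a b : nat)
| RMul (dst a b : nat)
| RLoad (dst a b : nat)
| RStore (a b src : nat)
| JEqN (a b t : nat)
| JLtN (a b t : nat)
| JLeR (a b t : nat)
| Jmp (t : nat)
| Halt.

Section Machine.
Variable R : realFieldType.

Record mstate := MState {
  pc : nat;
  nreg : nat -> nat;
  rreg : nat -> R;
  nmem : nat -> nat -> nat;
  rmem : nat -> nat -> R }.

Definition upd (T : Type) (f : nat -> T) (i : nat) (v : T) : nat -> T :=
  fun x => if x == i then v else f x.

Definition upd2 (T : Type) (f : nat -> nat -> T) (i j : nat) (v : T) :=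
  fun x y => if (x == i) && (y == j) then v else f x y.

Definition step (P : seq instr) (st : mstate) : option mstate :=
  let: MState c N X NM XM := st in
  if (size P <= c)%N then None else
  match nth Halt P c with
  | NConst r k => Some (MState c.+1 (upd N r k) X NM XM)
  | NAdd r a b => Some (MState c.+1 (upd N r (N a + N b)%N) X NM XM)
  | NSub r a b => Some (MState c.+1 (upd N r (N a - N b)%N) X NM XM)
  | NLoad r a b => Some (MState c.+1 (upd N r (NM (N a) (N b))) X NM XM)
  | NStore a b r => Some (MState c.+1 N X (upd2 NM (N a) (N b) (N r)) XM)
  | RConst r k => Some (MState c.+1 N (upd X r k%:R) NM XM)
  | RAdd r a b => Some (MState c.+1 N (upd X r (X a + X b)) NM XM)
  | RSub r a b => Some (MState c.+1 N (upd X r (X a - X b)) NM XM)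
  | RMul r a b => Some (MState c.+1 N (upd X r (X a * X b)) NM XM)
  | RLoad r a b => Some (MState c.+1 N (upd X r (XM (N a) (N b))) NM XM)
  | RStore a b r => Some (MState c.+1 N X NM (upd2 XM (N a) (N b) (X r)))
  | JEqN a b t => Some (MState (if N a == N b then t else c.+1) N X NM XM)
  | JLtN a b t => Some (MState (if (N a < N b)%N then t else c.+1) N X NM XM)
  | JLeR a b t => Some (MState (if X a <= X b then t else c.+1) N X NM XM)
  | Jmp t => Some (MState t N X NM XM)
  | Halt => None
  end.

Fixpoint run (P : seq instr) (fuel : nat) (st : mstate) : option mstate :=
  match step P st with
  | None => Some st
  | Some st' => if fuel is f.+1 then run P f st' else None
  end.

(* Input encoding of an instance:
   N[0] = n, N[1] = K, X[0] = alpha,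
   NM[j+1][k] = 1 if j -> k (j,k < n), else 0,
   XM[i][j] = p_j(S_i), XM[K+i][j] = d_j(S_i), XM[2K+i][j] = w_j(S_i),
   everything else 0. *)
Definition init_state (n K : nat) (prec : nat -> nat -> bool) (alpha : R)
    (p d w : nat -> nat -> R) : mstate :=
  MState 0
    (fun r => if r == 0%N then n else if r == 1%N then K else 0%N)
    (fun r => if r == 0%N then alpha else 0)
    (fun a b => if a is j.+1 then
                  (if [&& (j < n)%N, (b < n)%N & prec j b] then 1%N else 0%N)
                else 0%N)
    (fun a b => if (n <= b)%N then 0 else
                if (a < K)%N then p a b
                else if (a < 2 * K)%N then d (a - K)%N b
                else if (a < 3 * K)%N then w (a - 2 * K)%N b
                else 0).

Definition output (n : nat) (st : mstate) : seq nat :=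
  [seq nmem st 0 t | t <- iota 0 n].

End Machine.

(* Main.v *)
Require Import Defs.
From mathcomp Require Import all_boot all_order all_algebra.
From mathcomp Require Import zify ring lra.
Set Implicit Arguments. Unset Strict Implicit. Unset Printing Implicit Defensive.
Import Order.TTheory GRing.Theory Num.Theory.
Local Open Scope ring_scope.

(* The minimum over scenarios is attained at some pivot k, so it suffices to minimise,
   for each k, the combination alpha * F + (1 - alpha) * G of two bottleneck costs,
   where F is the maximum cost over all scenarios and G the cost under k.  With [maxlate]
   and [late k] the costs of completing a job last among a set U, both monotone in U,
   a schedule with F <= V and G <= g exists iff every nonempty U has a job without
   successors in U whose costs are at most V and g: remove such jobs from the end.
   With K scenarios there may be more than O(n^2) Pareto-optimal pairs (V, g), so running
   Lawler's rule once per pair is too slow.  Instead, let U be a set where the rule is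
   stuck, th its load under k and H the jobs with G-cost at most g at time th.  These
   costs are affine in th up to positive parts, hence H is cut off by a line in a
   planar arrangement, and there are only O(n^2) such cuts H.  For each of them a single
   run of Lawler's rule, restricted to H, yields constraints "F >= t or G >= l", at most n
   per cut, which together describe all attainable pairs.  Sweeping the at most n^3
   constraints by decreasing l, in n groups of n chains so that the next one is found
   in O(n) time, enumerates sufficient candidates (V, g).  Each pivot thus costs
   O(n^2 * K n^2 + n^3 * n) steps.

   All loops of the program are bounded by n or K, so its running time can be read
   off its syntax. *)

(** * Maxima, minima and planar cuts *)

Section BigMax.
Variable R : realFieldType.

(** The run of Lawler's rule inside a cut H never looks at the bounds V and g. With remaining set U
    it records t, the least F-cost of a sink of U in H, and l, the least G-cost at U of a job
    outside H: the job of U that a schedule completes last pays one of the two. Conversely, if W is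
    stuck for (V, g) and H is its cut, no step with t <= V removes a job of W, so W stays inside the
    current U and by monotonicity the recorded l exceeds g. Hence (V, g) is attainable once V is at
    least the minimum of F and every chain shows some l <= g preceded only by steps with t <= V.
    This dictates the sweep: V is a lower bound on F for the schedules not yet covered, g is the
    largest current l. A schedule with G >= g is no better than the candidate (V, g); one with G < g
    satisfies F >= t for the constraint at hand, so V may be raised to t. The job a delimiting a cut
    lies outside it and is never removed, so chains have fewer than n steps and n^3 iterations
    exhaust them. *)

Lemma bigmax_seq_le (I : eqType) (s : seq I) (F : I -> R) (x b : R) :
  x <= b -> (forall i, i \in s -> F i <= b) -> \big[Num.max/x]_(i <- s) F i <= b.
Proof.
move=> hx; elim: s => [|i s IHs] h; rewrite ?big_nil ?big_cons // ge_max h ?mem_head //=.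
by apply: IHs => j js; apply: h; rewrite inE js orbT.
Qed.

Lemma le_bigmax_seq_mem (I : eqType) (s : seq I) (F : I -> R) (x : R) i :
  i \in s -> F i <= \big[Num.max/x]_(i <- s) F i.
Proof.
elim: s => // j s IHs; rewrite inE big_cons le_max => /orP [/eqP ->|/IHs ->].
  by rewrite lexx.
by rewrite orbT.
Qed.

Lemma bigmax_seq_ge0 (I : eqType) (s : seq I) (F : I -> R) :
  0 <= \big[Num.max/0]_(i <- s) F i.
Proof. by elim: s => [|i s IHs]; rewrite ?big_nil ?big_cons // le_max IHs orbT. Qed.

Lemma bigmax_nat_recr (F : nat -> R) i :
  \big[Num.max/0]_(0 <= j < i.+1) F j = Num.max (\big[Num.max/0]_(0 <= j < i) F j) (F i).
Proof.
rewrite /index_iota !subn0 -addn1 iotaD /= add0n.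
elim: (iota 0 i) => [|j s IHs] /=; first by rewrite big_cons !big_nil maxC.
by rewrite !big_cons IHs maxA.
Qed.

Lemma bigmin_seq_le (I : eqType) (s : seq I) (F : I -> R) (x : R) i :
  i \in s -> \big[Num.min/x]_(j <- s) F j <= F i.
Proof.
elim: s => // j s IHs; rewrite inE big_cons ge_min => /orP [/eqP ->|/IHs ->].
  by rewrite lexx.
by rewrite orbT.
Qed.

Lemma bigmin_seq_attained (I : Type) (s : seq I) (F : I -> R) (x : R) :
  \big[Num.min/x]_(j <- s) F j = x \/ exists i, \big[Num.min/x]_(j <- s) F j = F i.
Proof.
elim: s => [|j s [IHs|[i IHs]]]; rewrite ?big_nil ?big_cons ?IHs; first by left.
  by rewrite /Num.min; case: ifP => _; [right; exists j | left].
by right; rewrite /Num.min; case: ifP => _; [exists j | exists i].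
Qed.

Lemma exists_argmin (n : nat) (Q : pred nat) (f : nat -> R) :
  (exists2 z, (z < n)%N & Q z) ->
  exists z, [/\ (z < n)%N, Q z & forall y, (y < n)%N -> Q y -> f z <= f y].
Proof.
case=> z0 z0n Qz0.
case: (@Order.TotalTheory.arg_minP _ R 'I_n (Ordinal z0n) (fun z => Q z) (fun z => f z)) => // z Qz zmin.
by exists z; split => // y yn Qy; apply: (zmin (Ordinal yn)).
Qed.

Lemma exists_argmin_lex (n : nat) (Q : pred nat) (f g : nat -> R) :
  (exists2 z, (z < n)%N & Q z) ->
  exists z, [/\ (z < n)%N, Q z & forall y, (y < n)%N -> Q y ->
    f z <= f y /\ (f y = f z -> g z <= g y)].
Proof.
move=> /(@exists_argmin n Q f) [z [zn Qz zmin]].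
have [|a [an /andP[Qa /eqP faz] amin]] := @exists_argmin n (fun y => Q y && (f y == f z)) g.
  by exists z => //; rewrite Qz eqxx.
exists a; split => // y yn Qy; rewrite faz; split; first exact: zmin.
by move=> fy; apply: amin => //; rewrite Qy fy eqxx.
Qed.

End BigMax.

Section Cuts.
Variable R : realFieldType.

(* Division-free test whether the line of slope [u] and intercept [- e] is negative
   just before the abscissa [B / A]; [A = 0], [B = 1] stands for infinity. *)
Definition cut_test (A B u e : R) : bool :=
  (u * B < e * A) || ((u * B == e * A) && ((0 < u) || ((u == 0) && (0 < e)))).

(** The machine cannot divide, so the abscissa [B / A] stays a fraction; a positive denominator
    allows cross-multiplication. Parallel lines, in particular [x = a], give the code [(0, 1)] of
    infinity. *)
Definition norm_dir (A B : R) : R * R :=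
  if A == 0 then (0, 1) else if A < 0 then (- A, - B) else (A, B).

(** The lines [w z * t - c z] strictly below line [a] just before [a] and [x] cross. Two job indices
    determine the cut, whence [n ^ 2] candidates. *)
Definition cut (w c : nat -> R) (a x z : nat) : bool :=
  let AB := norm_dir (w x - w a) (c x - c a) in
  cut_test AB.1 AB.2 (w z - w a) (c z - c a).

Lemma cut_test_slope (A T u e : R) : 0 < A ->
  cut_test A (A * T) u e =
  (u * T < e) || ((u * T == e) && ((0 < u) || ((u == 0) && (0 < e)))).
Proof.
move=> A0; rewrite /cut_test mulrCA [e * _]mulrC ltr_pM2l //.
by rewrite (inj_eq (mulfI (lt0r_neq0 A0))).
Qed.

Lemma cut_self (w c : nat -> R) a x : cut w c a x a = false.
Proof. by rewrite /cut /cut_test !subrr !mul0r !ltxx !eqxx. Qed.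

(* Increase [th] until just before the first change of the cut-off set: a line
   [z] then passes through the same point as the line [a]. *)
Lemma cut_realized (n : nat) (w c : nat -> R) (th : R) (a : nat) :
  (a < n)%N ->
  (forall z, (z < n)%N -> w z * th - c z = w a * th - c a -> w a <= w z) ->
  exists2 x, (x < n)%N & forall z, (z < n)%N ->
    cut w c a x z = (w z * th - c z < w a * th - c a).
Proof.
move=> an tie.
pose u z := w z - w a; pose e z := c z - c a.
have lineE z : (w z * th - c z < w a * th - c a) = (u z * th < e z).
  by apply/idP/idP; rewrite /u /e; lra.
(* Among the lines tied with [a] at [th] none has a smaller slope, so none dips below [a] right
   after [th]. *)
have tie' z : (z < n)%N -> u z < 0 -> u z * th != e z.
  move=> zn uz; apply/eqP => h.
  have : w a <= w z by apply: tie => //; move: h; rewrite /u /e; lra.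
  by move: uz; rewrite /u; lra.
(* [Q z]: the comparison of [z] with [a] flips strictly after [th], at abscissa [e z / u z]. The
   earliest such [z] becomes [x]. *)
pose Q z := ((0 < u z) && (u z * th < e z)) || ((u z < 0) && (e z < u z * th)).
have [/existsP [[x0 x0n] /= Qx0]|noQ] := boolP [exists z : 'I_n, Q z].
  have [|x [xn Qx xmin]] := @exists_argmin R n Q (fun z => e z / u z).
    by exists x0.
  exists x => // z zn; rewrite lineE.
  set T := e x / u x.
  have ux0 : u x != 0.
    by case/orP: Qx => /andP [h _]; rewrite ?(lt0r_neq0 h) ?(ltr0_neq0 h).
  have eT : e x = u x * T by rewrite /T mulrC divfK.
  have thT : th < T.
    case/orP: Qx => /andP [h1 h2]; rewrite /T.
      by rewrite ltr_pdivlMr // mulrC.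
    by rewrite ltr_ndivlMr // mulrC.
  have -> : cut w c a x z = (u z * T < e z) ||
              ((u z * T == e z) && ((0 < u z) || ((u z == 0) && (0 < e z)))).
    rewrite /cut /norm_dir -/(u x) -/(e x) (negbTE ux0) -/(u z) -/(e z) eT.
    case: (ltP (u x) 0) => ux /=.
      by rewrite -mulNr; apply: cut_test_slope; rewrite oppr_gt0.
    by apply: cut_test_slope; rewrite lt_neqAle eq_sym ux0.
  have [uz|uz|uz] := ltgtP (u z) 0.
  - have -> : (u z * T == e z) && (false || (false && (0 < e z))) = false by rewrite andbF.
    rewrite orbF.
    have [Qz|] := boolP (e z < u z * th).
      have : T <= e z / u z by apply: xmin; rewrite // /Q uz Qz orbT.
      rewrite ler_ndivlMr // mulrC => h.
      by rewrite (lt_gtF Qz) ltNge h.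
    rewrite -leNgt le_eqVlt (negbTE (tie' z zn uz)) /= => h; rewrite h.
    by apply: lt_trans h; rewrite ltr_nM2l.
  - rewrite /= andbT orbC -le_eqVlt.
    have [Qz|] := boolP (u z * th < e z).
      have : T <= e z / u z by apply: xmin; rewrite // /Q uz Qz.
      by rewrite ler_pdivlMr // mulrC.
    rewrite -leNgt => h; apply/negbTE; rewrite -ltNge.
    by apply: le_lt_trans h _; rewrite ltr_pM2l.
  - rewrite uz !mul0r /=; case: ltP => //= _; exact: andbF.
(* No comparison flips after [th]: the cut is already the one at infinity, coded by [x = a]. *)
exists a => // z zn; rewrite lineE.
have nQ : ~~ Q z by apply: contra noQ => Qz; apply/existsP; exists (Ordinal zn).
rewrite /cut /norm_dir subrr eqxx /cut_test -/(u z) -/(e z) /= mulr1 mulr0.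
move: nQ; rewrite /Q negb_or.
have [uz|uz|uz] /= := ltgtP (u z) 0.
- by rewrite -leNgt le_eqVlt (negbTE (tie' z zn uz)) /= => ->.
- by rewrite andbT => /negbTE ->.
- by rewrite uz mul0r.
Qed.

End Cuts.

(** * Lateness and Lawler's rule *)

Section Lateness.
Variables (R : realFieldType) (n K : nat) (prec : nat -> nat -> bool).
Variables (p d w : nat -> nat -> R).
Hypothesis prec_spo : strict_partial_order n prec.
Hypothesis data_ge0 : forall i j, (i < K)%N -> (j < n)%N ->
  0 <= p i j /\ 0 <= d i j /\ 0 <= w i j.

Definition load (i : nat) (U : pred nat) : R := \sum_(0 <= j < n | U j) p i j.

Definition late (i z : nat) (U : pred nat) : R :=
  w i z * Num.max 0 (load i U - d i z).

Definition maxlate (z : nat) (U : pred nat) : R :=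
  \big[Num.max/0]_(0 <= i < K) late i z U.

Definition maxcost (s : seq nat) : R :=
  \big[Num.max/0]_(0 <= i < K) cost p d w s i.

Definition sink (U : pred nat) (z : nat) : Prop :=
  [/\ (z < n)%N, U z & forall y, (y < n)%N -> U y -> ~~ prec z y].

Definition inhabited (U : pred nat) : Prop := exists2 j, (j < n)%N & U j.

Lemma load_mono i (U W : pred nat) : (i < K)%N ->
  (forall j, (j < n)%N -> U j -> W j) -> load i U <= load i W.
Proof.
move=> iK UW; rewrite /load big_mkcond [X in _ <= X]big_mkcond /= !big_mkord.
apply: ler_sum => j _; case: ifP => [/UW ->//|_]; case: ifP => // _.
by case: (data_ge0 iK (ltn_ord j)).
Qed.

Lemma eq_load i (U W : pred nat) :
  (forall j, (j < n)%N -> U j = W j) -> load i U = load i W.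
Proof.
move=> UW; rewrite /load big_mkcond [RHS]big_mkcond /= !big_mkord.
by apply: eq_bigr => j _; rewrite UW.
Qed.

Lemma eq_late i z (U W : pred nat) :
  (forall j, (j < n)%N -> U j = W j) -> late i z U = late i z W.
Proof. by move=> UW; rewrite /late (eq_load _ UW). Qed.

Lemma eq_maxlate z (U W : pred nat) :
  (forall j, (j < n)%N -> U j = W j) -> maxlate z U = maxlate z W.
Proof. by move=> UW; apply: eq_bigr => i _; apply: eq_late. Qed.

Lemma late_load i z (U : pred nat) (t : R) : (i < K)%N -> (z < n)%N ->
  load i U <= t -> late i z U <= w i z * Num.max 0 (t - d i z).
Proof.
move=> iK zn h; rewrite /late ler_wpM2l //; first by case: (data_ge0 iK zn) => _ [].
by rewrite ge_max !le_max lexx /= lerB ?orbT.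
Qed.

Lemma late_mono i z (U W : pred nat) : (i < K)%N -> (z < n)%N ->
  (forall j, (j < n)%N -> U j -> W j) -> late i z U <= late i z W.
Proof. by move=> iK zn UW; apply: late_load => //; apply: load_mono. Qed.

Lemma late_ge0 i z U : (i < K)%N -> (z < n)%N -> 0 <= late i z U.
Proof.
move=> iK zn; rewrite /late mulr_ge0 ?le_max ?lexx //.
by case: (data_ge0 iK zn) => _ [].
Qed.

Lemma maxlate_leP z (U : pred nat) (V : R) : 0 <= V ->
  (maxlate z U <= V) <-> (forall i, (i < K)%N -> late i z U <= V).
Proof.
move=> V0; split => h.
  move=> i iK; apply: le_trans h; rewrite /maxlate.
  by apply: (@le_bigmax_seq_mem R _ _ (fun i => late i z U)); rewrite mem_index_iota.
by apply: bigmax_seq_le => // i; rewrite mem_index_iota => /h.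
Qed.

Lemma maxlate_ge0 z U : 0 <= maxlate z U.
Proof. exact: bigmax_seq_ge0. Qed.

Lemma maxlate_mono z (U W : pred nat) : (z < n)%N ->
  (forall j, (j < n)%N -> U j -> W j) -> maxlate z U <= maxlate z W.
Proof.
move=> zn UW; apply/maxlate_leP; first exact: maxlate_ge0.
move=> i iK; apply: le_trans (late_mono iK zn UW) _.
by move: i iK; apply/maxlate_leP => //; exact: maxlate_ge0.
Qed.

Lemma cost_le_maxcost s i : (i < K)%N -> cost p d w s i <= maxcost s.
Proof.
move=> iK; apply: (@le_bigmax_seq_mem R _ _ (fun i => cost p d w s i)).
by rewrite mem_index_iota.
Qed.

(** A job of [U] with the fewest successors is a sink: by transitivity and irreflexivity each of its
    successors has strictly fewer. *)
Lemma exists_sink (U : pred nat) : inhabited U -> exists z, sink U z.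
Proof.
case: prec_spo => irr tr.
pose succs z := [set y : 'I_n | prec z y].
move=> /(@exists_argmin rat n U (fun z => #|succs z|%:R)) [z [zn Uz zmin]].
exists z; split => // y yn Uy; apply/negP => zy.
have := zmin y yn Uy; rewrite ler_nat leqNgt => /negP; apply.
apply: proper_card; apply/properP; split.
  apply/subsetP => x; rewrite !inE; exact: tr.
by exists (Ordinal yn); rewrite !inE //= irr.
Qed.

Lemma feasible_uniq s : feasible n prec s -> uniq s /\ s =i iota 0 n.
Proof. by case=> pe _; split; [rewrite (perm_uniq pe) iota_uniq|exact: perm_mem]. Qed.

(* All of [U] is completed when the job of [U] scheduled last is. *)
Lemma feasible_last s (U : pred nat) : feasible n prec s -> inhabited U ->
  exists z, sink U z /\ forall i, (i < K)%N -> late i z U <= cost p d w s i.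
Proof.
move=> fs; have [us ms] := feasible_uniq fs; case: (fs) => pe prs.
case=> z0 z0n Uz0.
have [z [zn Uz zmax]] : exists z, [/\ (z < n)%N, U z &
    forall y, (y < n)%N -> U y -> (index y s <= index z s)%N].
  case: (@arg_maxnP 'I_n (Ordinal z0n) (fun z => U z) (fun z => index (val z) s)) => // z Uz zmax.
  by exists z; split => // y yn Uy; apply: (zmax (Ordinal yn)).
exists z; split.
  split => // y yn Uy; apply/negP => /(prs _ _ zn yn).
  by rewrite ltnNge zmax.
move=> i iK.
have zs : z \in s by rewrite ms mem_iota.
apply: le_trans (@le_bigmax_seq_mem R _ s _ 0 z zs).
apply: late_load => //.
rewrite /load /completion /index_iota subn0 -(perm_big _ pe) /=.
rewrite -[in X in X <= _](cat_take_drop (index z s).+1 s) big_cat /=.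
(* [z] has the largest index in [U], so whatever comes after it lies outside [U]. *)
have noU j : j \in drop (index z s).+1 s -> U j = false.
  move=> jd; apply/negP => Uj.
  have js : j \in s by apply: mem_drop jd.
  have jn : (j < n)%N by move: js; rewrite ms mem_iota.
  have jt : j \in take (index z s).+1 s.
    rewrite in_take // ltnS; exact: zmax.
  move: us; rewrite -{1}(cat_take_drop (index z s).+1 s) cat_uniq => /and3P [_ /hasPn h _].
  by move: (h _ jd); rewrite /= jt.
rewrite [X in _ + X <= _]big_seq_cond [X in _ + X <= _]big1 ?addr0; last first.
  by move=> j /andP [/noU ->].
rewrite big_mkcond /= big_seq [X in _ <= X]big_seq; apply: ler_sum => j.
move=> /mem_take; rewrite ms mem_iota => /andP [_ jn].
by case: ifP => // _; case: (data_ge0 iK jn).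
Qed.

(** * Removing sinks one at a time and scheduling in reverse order *)

Section Peeling.
Variables (U : nat -> pred nat) (z : nat -> nat) (len : nat).
Hypothesis U0 : forall j, (j < n)%N -> U 0%N j.
Hypothesis z_sink : forall m, (m < len)%N -> sink (U m) (z m).
Hypothesis US : forall m j, (m < len)%N -> (j < n)%N -> U m.+1 j = U m j && (j != z m).

Lemma peel_notin m j : (m <= len)%N -> (j < n)%N ->
  U m j = (j \notin [seq z i | i <- iota 0 m]).
Proof.
elim: m => [|m IHm] mlen jn; first by rewrite U0.
by rewrite US // IHm ?(ltnW mlen) // -addn1 iotaD map_cat mem_cat negb_or /= inE.
Qed.

Lemma peel_count m : (m <= len)%N -> (count (U m) (iota 0 n) + m = n)%N.
Proof.
elim: m => [|m IHm] mlen.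
  rewrite addn0 -[RHS](size_iota 0 n); apply/eqP; rewrite -all_count.
  by apply/allP => j; rewrite mem_iota => /U0.
rewrite -[RHS](IHm (ltnW mlen)) addnS -addSn; congr (_ + _)%N.
have [zn Uz _] := z_sink mlen.
rewrite -[RHS]size_filter -[RHS](count_predC (pred1 (z m))) !count_filter.
have -> : count [predI pred1 (z m) & U m] (iota 0 n) = 1%N.
  rewrite -(@eq_count _ (pred1 (z m))).
    by rewrite count_uniq_mem ?iota_uniq // mem_iota zn.
  by move=> j; rewrite /= !inE -topredE /=; case: eqVneq => [->|_] /=; rewrite ?Uz.
rewrite add1n; congr _.+1; apply: eq_in_count => j.
by rewrite mem_iota => jn /=; rewrite US // andbC.
Qed.

Lemma peel_len a : (a < n)%N -> U len a -> (len < n)%N.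
Proof.
move=> an Ua; have /= := peel_count (leqnn len).
have : (0 < count (U len) (iota 0 n))%N.
  by rewrite -has_count; apply/hasP; exists a; rewrite ?mem_iota.
lia.
Qed.

End Peeling.

(** In the reversed order [z m] has position [n - m.+1] and the jobs processed up to it are exactly
    those of [U m], so [late i (z m) (U m)] is its true cost. Precedence holds because every
    successor of a sink of [U m] was removed earlier. *)
Lemma peel_schedule (U : nat -> pred nat) (z : nat -> nat) :
  (forall j, (j < n)%N -> U 0%N j) ->
  (forall m, (m < n)%N -> sink (U m) (z m)) ->
  (forall m j, (m < n)%N -> (j < n)%N -> U m.+1 j = U m j && (j != z m)) ->
  let s := rev [seq z m | m <- iota 0 n] in
  feasible n prec s /\
  forall i (V : R), (i < K)%N -> 0 <= V ->
    (forall m, (m < n)%N -> late i (z m) (U m) <= V) -> cost p d w s i <= V.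
Proof.
move=> U0 zs US s.
have zE m j : (m <= n)%N -> (j < n)%N -> U m j = (j \notin [seq z i | i <- iota 0 m]).
  by move=> *; apply: peel_notin; eauto.
have zlt m : (m < n)%N -> (z m < n)%N by move=> /zs [].
have zinj m1 m2 : (m1 < m2)%N -> (m2 < n)%N -> z m1 != z m2.
  move=> m12 m2n; have [zn] := zs _ m2n; rewrite zE ?(ltnW m2n) // => h _.
  apply: contra h => /eqP <-; apply: map_f; rewrite mem_iota; lia.
have ut : uniq [seq z m | m <- iota 0 n].
  rewrite map_inj_in_uniq ?iota_uniq // => m1 m2; rewrite !mem_iota => h1 h2 e.
  case: (ltngtP m1 m2) => // h; first by have := zinj _ _ h; rewrite e eqxx; lia.
  by have := zinj _ _ h; rewrite e eqxx; lia.
have us : uniq s by rewrite rev_uniq.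
have ss : size s = n by rewrite size_rev size_map size_iota.
have pe : perm_eq s (iota 0 n).
  apply: uniq_perm => //; first exact: iota_uniq.
  apply: (uniq_min_size us _ _).2 => [j|]; last by rewrite ss size_iota.
  by rewrite mem_rev => /mapP [m]; rewrite !mem_iota => mn ->; apply: zlt.
have zi j : (j < n)%N -> exists2 m, (m < n)%N & j = z m.
  move=> jn; have : j \in s by rewrite (perm_mem pe) mem_iota.
  by rewrite mem_rev => /mapP [m]; rewrite mem_iota => mn ->; exists m.
have nths m : (m < n)%N -> nth 0%N s (n - m.+1) = z m.
  move=> mn; rewrite nth_rev size_map size_iota; last lia.
  rewrite (nth_map 0%N) ?size_iota ?nth_iota; try lia.
  congr z; lia.
have idx m : (m < n)%N -> index (z m) s = (n - m.+1)%N.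
  by move=> mn; rewrite -(nths m mn) index_uniq // ss; lia.
split.
  split=> // i j /zi [mi min ->] /zi [mj mjn ->] pij.
  rewrite !idx //.
  have [_ _ h] := zs _ min.
  have : ~~ U mi (z mj) by apply/negP => Uj; move: (h _ (zlt _ mjn) Uj); rewrite pij.
  rewrite zE ?(ltnW min) ?zlt // negbK => /mapP [m']; rewrite mem_iota add0n => hm e.
  have -> : mj = m'.
    case: (ltngtP mj m') => // hh; first by have := zinj _ _ hh; rewrite e eqxx; lia.
    by have := zinj _ _ hh; rewrite e eqxx; lia.
  lia.
move=> i V iK V0 h; apply: bigmax_seq_le => // j.
rewrite (perm_mem pe) mem_iota => /zi [m mn ->].
apply: le_trans (h m mn); rewrite /late le_eqVlt; apply/orP; left; apply/eqP.
congr (_ * Num.max _ (_ - _)).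
rewrite /completion idx // /load.
rewrite -[RHS]big_filter /index_iota subn0; apply: perm_big; apply: uniq_perm.
- exact: take_uniq.
- by rewrite filter_uniq ?iota_uniq.
move=> x; rewrite mem_filter mem_iota add0n /=.
have [xn|nx] := ltnP x n; last first.
  rewrite andbF; apply/negP => /mem_take; rewrite (perm_mem pe) mem_iota; lia.
rewrite andbT; have [mx mxn ->] := zi x xn.
rewrite in_take; last by rewrite mem_rev map_f // mem_iota.
rewrite idx // zE ?zlt ?(ltnW mn) //.
apply/idP/idP => h1.
  apply/mapP => -[m']; rewrite mem_iota => hm' e.
  have := zinj m' mx; rewrite e eqxx; lia.
rewrite ltnS leq_sub2l // ltnS leqNgt; apply: contra h1 => h1.
by apply: map_f; rewrite mem_iota.
Qed.

End Lateness.

(** * Chains of constraints and attainable pairs *)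

Section Chains.
Variables (R : realFieldType) (n K : nat) (prec : nat -> nat -> bool).
Variables (p d w : nat -> nat -> R).
Hypothesis prec_spo : strict_partial_order n prec.
Hypothesis data_ge0 : forall i j, (i < K)%N -> (j < n)%N ->
  0 <= p i j /\ 0 <= d i j /\ 0 <= w i j.

Local Notation sink := (sink n prec).
Local Notation inhabited := (inhabited n).
Local Notation late := (late n p d w).
Local Notation maxlate := (maxlate n K p d w).
Local Notation maxcost := (maxcost K p d w).

(* Lawler's backward rule restricted to the jobs of [H]: [z m] is the job of [H]
   removed from the end of [U m]. *)
Definition chain (H : pred nat) (U : nat -> pred nat) (z : nat -> nat) (len : nat) : Prop :=
  [/\ forall j, (j < n)%N -> U 0%N j,
      forall m, (m < len)%N -> sink (U m) (z m) /\ H (z m),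
      forall m y, (m < len)%N -> sink (U m) y -> H y -> maxlate (z m) (U m) <= maxlate y (U m)
    & forall m j, (m < len)%N -> (j < n)%N -> U m.+1 j = U m j && (j != z m)].

(** The minimum ranges over all jobs outside [H], not only those in [U]; along a chain this makes no
    difference, as such jobs are never removed. *)
Definition is_minlate (k : nat) (H U : pred nat) (l : R) : Prop :=
  (forall y, (y < n)%N -> ~~ H y -> l <= late k y U) /\
  (exists y, [/\ (y < n)%N, ~~ H y & l = late k y U]).

Definition barred (H U : pred nat) : Prop := forall y, sink U y -> ~~ H y.

(** [l] has one entry more than [t]: the last one belongs to the set where no sink lies in [H], and
    it bounds the pivot cost without alternative. *)
Definition chain_table (k : nat) (H : pred nat) (len : nat) (t l : nat -> R) : Prop :=
  exists U z, [/\ chain H U z len, barred H (U len),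
    forall m, (m < len)%N -> t m = maxlate (z m) (U m)
    & forall m, (m <= len)%N -> is_minlate k H (U m) (l m)].

(** Stated through sets rather than schedules, so that a failure is witnessed by a single stuck set;
    a schedule is recovered by peeling. *)
Definition attainable (k : nat) (V g : R) : Prop := forall U, inhabited U ->
  exists z, [/\ sink U z, maxlate z U <= V & late k z U <= g].

Lemma chain_keep H U z len m a : chain H U z len -> (m <= len)%N ->
  (a < n)%N -> ~~ H a -> U m a.
Proof.
move=> [U0 zs _ US] + an nHa; elim: m => [|m IHm] mlen; first exact: U0.
rewrite US // IHm ?(ltnW mlen) //=; apply: contra nHa => /eqP ->.
by case: (zs m mlen).
Qed.

(** The job [a] is never removed. Strictness leaves room for the extra entry of [l] in a block of
    [n] columns and keeps the total number of advances below [n ^ 3]. *)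
Lemma chain_len H U z len a : chain H U z len -> (a < n)%N -> ~~ H a -> (len < n)%N.
Proof.
move=> ch an nHa; have Ua := chain_keep ch (leqnn len) an nHa.
case: ch => U0 zs _ US; apply: (@peel_len n prec U z len) Ua => //.
by move=> m /zs [].
Qed.

Lemma minlate_le k (H U : pred nat) l s : (k < K)%N -> feasible n prec s ->
  (forall y, (y < n)%N -> ~~ H y -> U y) ->
  is_minlate k H U l -> barred H U -> l <= cost p d w s k.
Proof.
move=> kK fs HU [lmin [y [yn nHy _]]] bar.
have [|z [zs zcost]] := feasible_last data_ge0 fs (U := U).
  by exists y; [|exact: HU].
apply: le_trans (zcost k kK); apply: lmin; last exact: bar.
by case: zs.
Qed.

(** The alternatives concern the job of [U m] that [s] completes last: inside [H] it costs at least
    as much as the greedy choice [z m], outside at least [l m]. *)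
Lemma table_valid k H len t l s m : (k < K)%N -> feasible n prec s ->
  chain_table k H len t l -> (m < len)%N ->
  t m <= maxcost s \/ l m <= cost p d w s k.
Proof.
move=> kK fs [U [z [ch bar tE lE]]] mlen.
have [zsm Hzm] := let: And4 _ zs _ _ := ch in zs m mlen.
have [|y [ys ycost]] := feasible_last data_ge0 fs (U := U m).
  by case: zsm => zn Uz _; exists (z m).
have [Hy|nHy] := boolP (H y).
  left; rewrite tE //; apply: (@le_trans _ _ (maxlate y (U m))).
    by case: ch => _ _ zmin _; apply: zmin.
  apply/(maxlate_leP _ _ _ _ _ _ _); first exact: bigmax_seq_ge0.
  by move=> i iK; apply: le_trans (ycost i iK) (cost_le_maxcost _ _ _ _ iK).
right; apply: le_trans (ycost k kK).
by case: (lE m (ltnW mlen)) => lmin _; apply: lmin => //; case: ys.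
Qed.

Lemma table_valid_last k H len t l s : (k < K)%N -> feasible n prec s ->
  chain_table k H len t l -> l len <= cost p d w s k.
Proof.
move=> kK fs [U [z [ch bar tE lE]]].
apply: (minlate_le kK fs) (lE len (leqnn _)) bar => y yn nHy.
exact: chain_keep ch (leqnn _) yn nHy.
Qed.

(** If [z m] were in [W], it would be a sink of [W] as well, [W] being contained in [U m], and by
    monotonicity its [maxlate] there would be at most [V], contrary to the assumption on [W]. *)
Lemma chain_absorbs H U z len (V : R) (m : nat) (W : pred nat) :
  chain H U z len -> (m <= len)%N ->
  (forall m', (m' < m)%N -> maxlate (z m') (U m') <= V) ->
  (forall y, sink W y -> H y -> V < maxlate y W) ->
  forall j, (j < n)%N -> W j -> U m j.
Proof.
move=> [U0 zs _ US] + + stuck.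
elim: m => [|m IHm] mlen hV j jn Wj; first exact: U0.
have WU y : (y < n)%N -> W y -> U m y.
  by apply: IHm; [exact: ltnW | move=> m' h; apply: hV; exact: leqW].
rewrite US // WU //=; apply/eqP => jz; subst j.
have [[zn Uz znp] Hz] := zs m mlen.
have sW : sink W (z m) by split => // y yn Wy; apply: znp => //; exact: WU.
move: (stuck _ sW Hz); rewrite ltNge => /negP; apply.
apply: le_trans (hV m (leqnn _)).
exact: maxlate_mono.
Qed.

(** A stuck set [W] is refuted through its own cut. The unrestricted chain covers the remaining
    case, where every job is cheap under the pivot and no line delimits a cut: it would absorb [W]
    into the empty set. *)
Lemma cut_tables_attainable k (V g : R) :
  (k < K)%N ->
  (exists U z, chain predT U z n /\ forall m, (m < n)%N -> maxlate (z m) (U m) <= V) ->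
  (forall a x, (a < n)%N -> (x < n)%N -> exists len t l m,
     [/\ chain_table k (cut (w k) (fun z => w k z * d k z) a x) len t l, (m <= len)%N,
         forall m', (m' < m)%N -> t m' <= V & l m <= g]) ->
  attainable k V g.
Proof.
move=> kK [U0 [z0 [ch0 hV0]]] tabs W Winh.
have U0n j : (j < n)%N -> ~~ U0 n j.
  case: ch0 => U00 zs _ US jn.
  have := @peel_count n prec U0 z0 n U00 (fun m h => (zs m h).1) US n (leqnn _).
  move=> cnt; have : ~~ has (U0 n) (iota 0 n) by rewrite has_count; lia.
  by move=> /hasPn; apply; rewrite mem_iota.
pose Q y := [&& W y, [forall x : 'I_n, W x ==> ~~ prec y x],
               maxlate y W <= V & late k y W <= g].
have [/existsP [[y yn] /= /and4P [Wy /forallP ys y1 y2]]|noQ] := boolP [exists y : 'I_n, Q y].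
  exists y; split => //; split => // x xn Wx.
  by have := ys (Ordinal xn); rewrite /= Wx.
have {noQ} stuck y : sink W y -> late k y W <= g -> V < maxlate y W.
  move=> [yn Wy ys] yg; rewrite ltNge; apply: contra noQ => yV.
  apply/existsP; exists (Ordinal yn); rewrite /Q /= Wy yV yg !andbT.
  by apply/forallP => x; apply/implyP => Wx; apply: ys.
exfalso.
have n0 : (0 < n)%N by case: Winh => j; lia.
(* Every [l] is a lateness, so any table shows [0 <= g]. This lets [lateE] drop the positive part
   and makes the test affine in [th]. *)
have g0 : 0 <= g.
  have [len [t [l [m [[U [z [_ _ _ lE]]] mlen _ lg]]]]] := tabs 0%N 0%N n0 n0.
  apply: le_trans lg; case: (lE m mlen) => _ [y [yn _ ->]].
  exact: (late_ge0 data_ge0).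
pose th := load n p k W; pose c z := w k z * d k z.
have lateE y : (y < n)%N -> (late k y W <= g) = (w k y * th - c y <= g).
  move=> yn; rewrite /late -/th /c -mulrBr.
  have wy : 0 <= w k y by case: (data_ge0 kK yn) => _ [].
  by rewrite maxr_pMr // mulr0 ge_max g0.
have [/existsP [[y0 y0n] /= y0g]|allg] := boolP [exists y : 'I_n, ~~ (late k y W <= g)]; last first.
  have : forall j, (j < n)%N -> W j -> U0 n j.
    apply: (chain_absorbs ch0 (leqnn n) hV0) => y ys _; apply: stuck => //.
    apply: contraNT allg => yg; case: ys => yn _ _.
    by apply/existsP; exists (Ordinal yn).
  case: Winh => j jn Wj /(_ j jn Wj); apply/negP; exact: U0n.
(* [a] is the lowest line above [g], so the cheap jobs are exactly those below it; ties go to the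
   smallest weight, as [cut_realized] demands. *)
have [|a [an ag amin]] := @exists_argmin_lex R n (fun y => ~~ (late k y W <= g))
    (fun y => w k y * th - c y) (w k).
  by exists y0.
have cutE y : (y < n)%N -> (w k y * th - c y < w k a * th - c a) = (late k y W <= g).
  move=> yn; apply/idP/idP => h.
    apply: contraLR h => h; rewrite -leNgt; by case: (amin y yn h).
  apply: (@le_lt_trans _ _ g); first by rewrite -lateE.
  by rewrite ltNge -lateE.
have [|x xn cutx] := @cut_realized R n (w k) c th a an.
  move=> y yn e; have nyg : ~~ (late k y W <= g) by rewrite -cutE // e ltxx.
  by have [_] := amin y yn nyg; apply.
have [len [t [l [m [[U [z [ch bar tE lE]]] mlen tV lg]]]]] := tabs a x an xn.
have HE y : (y < n)%N -> cut (w k) c a x y = (late k y W <= g).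
  by move=> yn; rewrite cutx // cutE.
have WU : forall j, (j < n)%N -> W j -> U m j.
  apply: (chain_absorbs (V := V) ch mlen).
    by move=> m1 h; rewrite -tE ?tV // (leq_trans h mlen).
  by move=> y ys; rewrite HE; [exact: stuck | case: ys].
case: (lE m mlen) => _ [y [yn nHy le]].
move: nHy; rewrite HE // => /negP; apply; apply: le_trans lg; rewrite le.
exact: (late_mono data_ge0).
Qed.

Lemma eq_sink (U W : pred nat) z : (forall j, (j < n)%N -> U j = W j) -> sink U z -> sink W z.
Proof.
move=> UW [zn Uz h]; split=> //; first by rewrite -UW.
by move=> y yn Wy; apply: h; rewrite // UW.
Qed.

Lemma chain_nil H : chain H (fun=> predT) id 0.
Proof. by []. Qed.

Lemma chain_rcons H U z len y (W : pred nat) : chain H U z len ->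
  sink (U len) y -> H y ->
  (forall x, sink (U len) x -> H x -> maxlate y (U len) <= maxlate x (U len)) ->
  (forall j, (j < n)%N -> W j = U len j && (j != y)) ->
  exists U' z', [/\ chain H U' z' len.+1, forall m, (m <= len)%N -> U' m = U m,
    forall m, (m < len)%N -> z' m = z m, z' len = y & U' len.+1 = W].
Proof.
move=> [U0 zs zmin US] sy Hy ymin WE.
pose U' m := if (m <= len)%N then U m else W.
pose z' m := if (m < len)%N then z m else y.
have U'E m : (m <= len)%N -> U' m = U m by rewrite /U' => ->.
have z'E m : (m < len)%N -> z' m = z m by rewrite /z' => ->.
have z'len : z' len = y by rewrite /z' ltnn.
have U'len : U' len.+1 = W by rewrite /U' ltnn.
exists U', z'; split=> //; split=> [j jn|m|m x|m j].
- by rewrite U'E // U0.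
- rewrite ltnS leq_eqVlt => /orP [/eqP ->|mlen]; first by rewrite z'len U'E.
  by rewrite z'E // U'E ?(ltnW mlen) //; apply: zs.
- rewrite ltnS leq_eqVlt => /orP [/eqP ->|mlen].
    by rewrite z'len U'E //; apply: ymin.
  by rewrite z'E // U'E ?(ltnW mlen) //; apply: zmin.
- rewrite ltnS leq_eqVlt => /orP [/eqP ->|mlen] jn; first by rewrite U'len z'len U'E // WE.
  by rewrite !U'E ?z'E ?(ltnW mlen) // US.
Qed.

Lemma chain_inhabited H U z len : chain H U z len -> (len < n)%N -> inhabited (U len).
Proof.
move=> [U0 zs _ US] lenn.
have := @peel_count n prec U z len U0 (fun m h => (zs m h).1) US len (leqnn _).
move=> cnt; have : has (U len) (iota 0 n) by rewrite has_count; lia.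
by move=> /hasP [j]; rewrite mem_iota => jn Uj; exists j.
Qed.

Lemma min_sink_le_maxcost (U : pred nat) z s : feasible n prec s -> inhabited U ->
  (forall y, sink U y -> maxlate z U <= maxlate y U) -> maxlate z U <= maxcost s.
Proof.
move=> fs iU zmin; have [y [ys ycost]] := feasible_last data_ge0 fs iU.
apply: le_trans (zmin y ys) _.
apply/(maxlate_leP _ _ _ _ _ _ _); first exact: bigmax_seq_ge0.
by move=> i iK; apply: le_trans (ycost i iK) (cost_le_maxcost _ _ _ _ iK).
Qed.

Lemma chain_table_ext k H H' len t l t' l' :
  (forall j, (j < n)%N -> H j = H' j) ->
  (forall m, (m < len)%N -> t m = t' m) -> (forall m, (m <= len)%N -> l m = l' m) ->
  chain_table k H len t l -> chain_table k H' len t' l'.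
Proof.
move=> HE tE lE [U [z [[U0 zs zmin US] bar tU lU]]]; exists U, z; split.
- split=> // [m mlen|m y mlen ys]; first by have [h1 h2] := zs m mlen; rewrite -HE; case: (h1).
  by rewrite -HE; [exact: zmin | case: ys].
- by move=> y ys; rewrite -HE; [exact: bar | case: ys].
- by move=> m mlen; rewrite -tE ?tU.
move=> m mlen; rewrite -lE //; have [h1 [y [yn nHy le]]] := lU m mlen; split.
  by move=> y' y'n; rewrite -HE //; exact: h1.
by exists y; rewrite -HE.
Qed.

End Chains.

(** * Structured programs for the real RAM *)

Inductive test : Type := TEqN (a b : nat) | TLtN (a b : nat) | TLeR (a b : nat).

(** A loop has a counter and a bound register, and [wf] restricts the latter to the registers of [n]
    and [K], so that termination and time become syntactic. *)
Inductive cmd : Type :=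
| Op (i : instr)
| Seq (c1 c2 : cmd)
| If (t : test) (c1 c2 : cmd)
| For (r b : nat) (c : cmd).

Definition jump (t : test) (l : nat) : instr :=
  match t with
  | TEqN a b => JEqN a b l
  | TLtN a b => JLtN a b l
  | TLeR a b => JLeR a b l
  end.

Definition straight (i : instr) : bool :=
  match i with
  | JEqN _ _ _ | JLtN _ _ _ | JLeR _ _ _ | Jmp _ | Halt => false
  | _ => true
  end.

(* Register 3 holds the constant 1. *)
Fixpoint compile (o : nat) (c : cmd) : seq instr :=
  match c with
  | Op i => [:: i]
  | Seq c1 c2 => let P1 := compile o c1 in P1 ++ compile (o + size P1) c2
  | If t c1 c2 =>
    let P2 := compile o.+1 c2 in
    let o1 := (o + size P2).+2 in
    let P1 := compile o1 c1 in
    (jump t o1 :: P2) ++ Jmp (o1 + size P1)%N :: P1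
  | For r b c =>
    let P := compile o.+3 c in
    [:: NConst r 0; JLtN r b o.+3; Jmp (o.+3 + (size P).+2)%N] ++
    P ++ [:: NAdd r r 3; Jmp o.+1]
  end.

Definition nwrite_op (i : instr) : seq nat :=
  match i with
  | NConst r _ | NAdd r _ _ | NSub r _ _ | NLoad r _ _ => [:: r]
  | _ => [::]
  end.

Definition rwrite_op (i : instr) : seq nat :=
  match i with
  | RConst r _ | RAdd r _ _ | RSub r _ _ | RMul r _ _ | RLoad r _ _ => [:: r]
  | _ => [::]
  end.

Definition nstore_op (i : instr) : seq nat := if i is NStore a _ _ then [:: a] else [::].
Definition rstore_op (i : instr) : seq nat := if i is RStore a _ _ then [:: a] else [::].

Section Footprint.
Variables (f : instr -> seq nat) (loopreg : bool).
(** For stores the items collected are the registers naming the rows, not the rows; in a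
    [disciplined] program these registers are constant. [loopreg] accounts for loop counters, which
    are natural registers. *)
Fixpoint footprint (c : cmd) : seq nat :=
  match c with
  | Op i => f i
  | Seq c1 c2 | If _ c1 c2 => footprint c1 ++ footprint c2
  | For r _ c => if loopreg then r :: footprint c else footprint c
  end.
End Footprint.

Definition nwrites := footprint nwrite_op true.
Definition rwrites := footprint rwrite_op false.
Definition nstores := footprint nstore_op false.
Definition rstores := footprint rstore_op false.

Fixpoint wf (c : cmd) : bool :=
  match c with
  | Op i => straight i
  | Seq c1 c2 | If _ c1 c2 => wf c1 && wf c2
  | For r b c => [&& (b == 0) || (b == 1), r != b, r \notin nwrites c & wf c]%N
  end.

Section Semantics.
Variable R : realFieldType.

Record store := Store {
  nr : nat -> nat;
  xr : nat -> R;
  nm : nat -> nat -> nat;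
  xm : nat -> nat -> R }.

Definition at_pc (o : nat) (m : store) : mstate R := MState o (nr m) (xr m) (nm m) (xm m).

Definition setN (r v : nat) (m : store) : store := Store (upd (nr m) r v) (xr m) (nm m) (xm m).

Definition exec_op (i : instr) (m : store) : store :=
  let N := nr m in let X := xr m in let NM := nm m in let XM := xm m in
  match i with
  | NConst r k => Store (upd N r k) X NM XM
  | NAdd r a b => Store (upd N r (N a + N b)%N) X NM XM
  | NSub r a b => Store (upd N r (N a - N b)%N) X NM XM
  | NLoad r a b => Store (upd N r (NM (N a) (N b))) X NM XM
  | NStore a b r => Store N X (upd2 NM (N a) (N b) (N r)) XM
  | RConst r k => Store N (upd X r k%:R) NM XM
  | RAdd r a b => Store N (upd X r (X a + X b)) NM XM
  | RSub r a b => Store N (upd X r (X a - X b)) NM XM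
  | RMul r a b => Store N (upd X r (X a * X b)) NM XM
  | RLoad r a b => Store N (upd X r (XM (N a) (N b))) NM XM
  | RStore a b r => Store N X NM (upd2 XM (N a) (N b) (X r))
  | _ => m
  end.

Definition eval_test (t : test) (m : store) : bool :=
  match t with
  | TEqN a b => nr m a == nr m b
  | TLtN a b => (nr m a < nr m b)%N
  | TLeR a b => xr m a <= xr m b
  end.

Fixpoint loop (f : store -> store) (r k : nat) (m : store) : store :=
  if k is k'.+1 then f (setN r k' (loop f r k' m)) else m.

(** A compiled loop leaves its counter equal to the bound, whence the outer [setN]. *)
Fixpoint denote (c : cmd) (m : store) : store :=
  match c with
  | Op i => exec_op i m
  | Seq c1 c2 => denote c2 (denote c1 m)
  | If t c1 c2 => if eval_test t m then denote c1 m else denote c2 m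
  | For r b c => setN r (nr m b) (loop (denote c) r (nr m b) m)
  end.

Definition frame (nw rw ns rs : seq nat) (m m' : store) : Prop :=
  [/\ forall x, x \notin nw -> nr m' x = nr m x,
      forall x, x \notin rw -> xr m' x = xr m x,
      forall y, y \notin [seq nr m a | a <- ns] -> forall z, nm m' y z = nm m y z
    & forall y, y \notin [seq nr m a | a <- rs] -> forall z, xm m' y z = xm m y z].

Definition cframe (c : cmd) := frame (nwrites c) (rwrites c) (nstores c) (rstores c).

(* Natural registers below 20 and real registers below 3 hold constants, which
   a program may not overwrite; arrays are addressed through such registers. *)
Definition disciplined (c : cmd) : bool :=
  [&& wf c, all (leq 20) (nwrites c), all (leq 3) (rwrites c) &
      all (gtn 20) (nstores c ++ rstores c)].

(** The second frame names its rows by registers read in [m2]; registers below 20 being constant,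
    these are the same rows as in [m1]. *)
Lemma frame_trans nw rw ns rs m1 m2 m3 :
  all (leq 20) nw -> all (gtn 20) (ns ++ rs) ->
  frame nw rw ns rs m1 m2 -> frame nw rw ns rs m2 m3 -> frame nw rw ns rs m1 m3.
Proof.
move=> nw20 s20 [a1 a2 a3 a4] [b1 b2 b3 b4].
have regE x : (x < 20)%N -> nr m2 x = nr m1 x.
  move=> x20; apply: a1; apply/negP => /(allP nw20); lia.
have rowE l : {subset l <= ns ++ rs} -> [seq nr m2 a | a <- l] = [seq nr m1 a | a <- l].
  by move=> sl; apply/eq_in_map => x /sl /(allP s20) /regE.
split=> [x h|x h|y h z|y h z]; rewrite ?b1 ?a1 ?b2 ?a2 //.
  rewrite b3 ?a3 // rowE // => x; rewrite mem_cat => ->//.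
by rewrite b4 ?a4 // rowE // => x; rewrite mem_cat orbC => ->.
Qed.

Lemma frame_weaken nw rw ns rs nw' rw' ns' rs' m m' :
  {subset nw <= nw'} -> {subset rw <= rw'} -> {subset ns <= ns'} -> {subset rs <= rs'} ->
  frame nw rw ns rs m m' -> frame nw' rw' ns' rs' m m'.
Proof.
move=> s1 s2 s3 s4 [a1 a2 a3 a4]; split=> [x h|x h|y h|y h].
- by apply: a1; apply: contra h => /s1.
- by apply: a2; apply: contra h => /s2.
- by apply: a3; apply: contra h => /mapP [a /s3 as' ->]; apply: map_f.
- by apply: a4; apply: contra h => /mapP [a /s4 as' ->]; apply: map_f.
Qed.

Lemma exec_op_frame i m : cframe (Op i) m (exec_op i m).
Proof.
by case: i => *; split=> //= x; rewrite inE /upd /upd2 => /negbTE ->.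
Qed.

Lemma setN_frame nw rw ns rs r v m : r \in nw -> frame nw rw ns rs m (setN r v m).
Proof. by move=> rnw; split=> //= x h; rewrite /upd; case: eqP h rnw => // -> /negP. Qed.

Lemma loop_frame r b c f k m : disciplined (For r b c) ->
  (forall m', cframe c m' (f m')) -> cframe (For r b c) m (loop f r k m).
Proof.
rewrite /disciplined /= => /and4P [_ /andP [n0 n1] x1 s1] fc.
have rin : r \in r :: nwrites c by rewrite mem_head.
have tr := @frame_trans (r :: nwrites c) (rwrites c) (nstores c) (rstores c).
have {}tr m1 m2 m3 := tr m1 m2 m3 (introT andP (conj n0 n1)) s1.
elim: k => [|k IHk] //=; apply: (tr _ _ _ IHk).
apply: tr (setN_frame _ _ _ k _ rin) _.
by apply: frame_weaken (fc _) => // x h; rewrite inE h orbT.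
Qed.

Lemma disciplined_for r b c : disciplined (For r b c) -> disciplined c.
Proof.
by rewrite /disciplined /= => /and4P [/and4P [_ _ _ ->] /andP [_ ->] -> ->].
Qed.

Lemma disciplined_cat c1 c2 :
  [&& wf c1 && wf c2, all (leq 20) (nwrites c1 ++ nwrites c2),
      all (leq 3) (rwrites c1 ++ rwrites c2) &
      all (gtn 20) ((nstores c1 ++ nstores c2) ++ (rstores c1 ++ rstores c2))] =
  disciplined c1 && disciplined c2.
Proof.
rewrite /disciplined !all_cat; apply/and4P/andP.
  by case=> /andP [-> ->] /andP [-> ->] /andP [-> ->] /andP [/andP [-> ->] /andP [-> ->]].
by case=> /and4P [-> -> -> /andP [-> ->]] /and4P [-> -> -> /andP [-> ->]].
Qed.

Lemma denote_frame c m : disciplined c -> cframe c m (denote c m).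
Proof.
elim: c m => [i|c1 IH1 c2 IH2|t c1 IH1 c2 IH2|r b c IH] m.
- by move=> _; apply: exec_op_frame.
- move=> d12; have := d12; rewrite {1}/disciplined /= disciplined_cat => /andP [d1 d2].
  have /and4P [_ n12 _ s12] := d12.
  apply: (@frame_trans _ _ _ _ _ (denote c1 m)) => //.
    by apply: frame_weaken (IH1 m d1) => x; rewrite /= ?mem_cat => ->.
  by apply: frame_weaken (IH2 _ d2) => x; rewrite /= ?mem_cat orbC => ->.
- rewrite {1}/disciplined /= disciplined_cat => /andP [d1 d2]; case: ifP => _.
    by apply: frame_weaken (IH1 m d1) => x; rewrite /= ?mem_cat => ->.
  by apply: frame_weaken (IH2 _ d2) => x; rewrite /= ?mem_cat orbC => ->.
move=> dF; have /and4P [_ n12 _ s12] := dF.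
apply: (@frame_trans _ _ _ _ _ (loop (denote c) r (nr m b) m)) => //=.
  apply: (@loop_frame r b) => // m'; exact: IH _ (disciplined_for dF).
by apply: setN_frame; rewrite mem_head.
Qed.

Lemma denote_forP (r b : nat) (c : cmd) m (I : nat -> store -> Prop) : disciplined (For r b c) ->
  I 0%N m ->
  (forall i m', (i < nr m b)%N -> cframe (For r b c) m m' -> I i m' ->
     I i.+1 (denote c (setN r i m'))) ->
  exists m', [/\ cframe (For r b c) m m', I (nr m b) m' &
    denote (For r b c) m = setN r (nr m b) m'].
Proof.
move=> dc I0 IS; exists (loop (denote c) r (nr m b) m).
suff h k : (k <= nr m b)%N -> cframe (For r b c) m (loop (denote c) r k m) /\ I k (loop (denote c) r k m).
  by have [] := h (nr m b) (leqnn _).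
elim: k => [|k IHk] //= klt; have [f1 i1] := IHk (ltnW klt).
split; last exact: IS.
by apply: (@loop_frame r b c (denote c) k.+1) => // m'; exact: denote_frame (disciplined_for dc).
Qed.

(* [sem] is sealed: simplification must not unfold named program fragments. *)
Definition sem (c : cmd) (m : store) : store := locked (denote c m).

Lemma sem_seq c1 c2 m : sem (Seq c1 c2) m = sem c2 (sem c1 m).
Proof. by rewrite /sem -!lock. Qed.

Lemma sem_op i m : sem (Op i) m = exec_op i m.
Proof. by rewrite /sem -lock. Qed.

Lemma sem_if t c1 c2 m :
  sem (If t c1 c2) m = if eval_test t m then sem c1 m else sem c2 m.
Proof. by rewrite /sem -!lock. Qed.

Lemma sem_frame c m : disciplined c -> cframe c m (sem c m).
Proof. by rewrite /sem -lock; exact: denote_frame. Qed.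

(** Each round also receives the frame from the initial state, so an invariant need only describe
    what the loop changes. *)
Lemma forP (r b : nat) (c : cmd) m (I : nat -> store -> Prop) : disciplined (For r b c) ->
  I 0%N m ->
  (forall i m', (i < nr m b)%N -> cframe (For r b c) m m' -> I i m' ->
     I i.+1 (sem c (setN r i m'))) ->
  exists m', [/\ cframe (For r b c) m m', I (nr m b) m' &
    sem (For r b c) m = setN r (nr m b) m'].
Proof.
move=> dc I0 IS; rewrite /sem -lock; apply: denote_forP => // i m' h1 h2 h3.
by have := IS i m' h1 h2 h3; rewrite /sem -lock.
Qed.

End Semantics.

(** * Simulation of structured programs by compiled code, with time *)

Section Compile.
Variables (R : realFieldType) (n K : nat).

(** A round costs its body plus test, increment and jump back; the other 3 pay for the reset, the
    last test and the exit jump. Charging both branches of an [If] only overestimates. *)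
Fixpoint duration (c : cmd) : nat :=
  match c with
  | Op _ => 1
  | Seq c1 c2 => duration c1 + duration c2
  | If _ c1 c2 => duration c1 + duration c2 + 2
  | For _ b c => (if b == 0 then n else K) * (duration c + 3) + 3
  end%N.

Definition code_at (P : seq instr) (o : nat) (C : seq instr) : Prop :=
  forall i, (i < size C)%N -> (o + i < size P)%N /\ nth Halt P (o + i) = nth Halt C i.

Lemma code_at_cat P o C1 C2 :
  code_at P o (C1 ++ C2) -> code_at P o C1 /\ code_at P (o + size C1) C2.
Proof.
move=> h; split => i hi.
  by have := h i; rewrite size_cat nth_cat hi; apply; rewrite ltn_addr.
have := h (size C1 + i)%N; rewrite size_cat nth_cat addnA => hh.
have [|-> ->] := hh; first lia.
by split=> //; rewrite ltnNge leq_addr /= addKn.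
Qed.

Lemma code_at_eq P o o' C : o = o' -> code_at P o C -> code_at P o' C.
Proof. by move->. Qed.

Lemma step_straight P (o : nat) (m : store R) i : straight i -> code_at P o [:: i] ->
  step P (at_pc o m) = Some (at_pc o.+1 (exec_op i m)).
Proof.
move=> si /(_ 0%N (leqnn _)) [h1 h2]; move: h1 h2; rewrite addn0 /step /= => h1 ->.
by rewrite leqNgt h1 /=; case: m => N X NM XM; case: i si.
Qed.

Lemma step_jump P (o : nat) (m : store R) t l : code_at P o [:: jump t l] ->
  step P (at_pc o m) = Some (at_pc (if eval_test t m then l else o.+1) m).
Proof.
move=> /(_ 0%N (leqnn _)) [h1 h2]; move: h1 h2; rewrite addn0 /step /= => h1 ->.
by rewrite leqNgt h1 /=; case: t.
Qed.

Lemma step_jmp P (o : nat) (m : store R) l : code_at P o [:: Jmp l] ->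
  step P (at_pc o m) = Some (at_pc l m).
Proof.
move=> /(_ 0%N (leqnn _)) [h1 h2]; move: h1 h2; rewrite addn0 /step /= => h1 ->.
by rewrite leqNgt h1.
Qed.

(** Quantifying over the remaining fuel [f] makes segments composable, with additive times. *)
Definition reaches P (t : nat) (s s' : mstate R) : Prop :=
  exists2 u, (u <= t)%N & forall f, run P (u + f) s = run P f s'.

Lemma reaches_step P s s' : step P s = Some s' -> reaches P 1 s s'.
Proof. by move=> h; exists 1%N => // f; rewrite add1n /= h. Qed.

Lemma reaches_trans P t1 t2 s1 s2 s3 :
  reaches P t1 s1 s2 -> reaches P t2 s2 s3 -> reaches P (t1 + t2) s1 s3.
Proof.
move=> [u1 h1 r1] [u2 h2 r2]; exists (u1 + u2)%N; first lia.
by move=> f; rewrite -addnA r1 r2.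
Qed.

Lemma reaches_leq P t1 t2 s1 s2 : (t1 <= t2)%N -> reaches P t1 s1 s2 -> reaches P t2 s1 s2.
Proof. by move=> h [u hu r]; exists u => //; lia. Qed.

Lemma compile_correct P (c : cmd) (o : nat) (m : store R) :
  disciplined c -> nr m 0 = n -> nr m 1 = K -> nr m 3 = 1%N ->
  code_at P o (compile o c) ->
  reaches P (duration c) (at_pc o m) (at_pc (o + size (compile o c)) (sem c m)).
Proof.
rewrite /sem -lock.
elim: c o m => [i|c1 IH1 c2 IH2|t c1 IH1 c2 IH2|r b c IH] o m.
- move=> /and4P [/= si _ _ _] _ _ _ h; rewrite addn1.
  by apply: reaches_step; apply: step_straight.
- rewrite {1}/disciplined /= disciplined_cat => /andP [d1 d2].
  move=> m0 m1 m3 /code_at_cat [h1 h2].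
  have [f1 _ _ _] := denote_frame m d1.
  have rE x : (x < 20)%N -> nr (denote c1 m) x = nr m x.
    by move=> x20; apply: f1; apply/negP => xw; have /and4P [_ /allP /(_ _ xw)] := d1; lia.
  apply: reaches_trans (IH1 o m d1 m0 m1 m3 h1) _.
  by rewrite size_cat addnA; apply: IH2; rewrite ?rE.
- rewrite {1}/disciplined /= disciplined_cat => /andP [d1 d2] m0 m1 m3.
  set P2 := compile o.+1 c2; set P1 := compile _ c1.
  rewrite -[_ :: _]/([:: jump t (o + size P2).+2] ++ P2 ++ [:: Jmp ((o + size P2).+2 + size P1)%N] ++ P1).
  move=> /code_at_cat [hj /code_at_cat [hc2 /code_at_cat [hJ hc1]]].
  have sj := reaches_step (step_jump m hj).
  move: hc2 hJ hc1; rewrite /= !addn1 => hc2 hJ hc1.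
  have -> : (o + (size (P2 ++ Jmp ((o + size P2).+2 + size P1) :: P1)).+1 =
             (o + size P2).+2 + size P1)%N by rewrite size_cat /=; lia.
  rewrite /denote -/denote; case: ifP sj => _ sj.
    apply: (@reaches_leq _ (1 + duration c1)); first lia.
    apply: reaches_trans sj (IH1 _ m d1 m0 m1 m3 _).
    by move: hc1; rewrite addSn.
  apply: (@reaches_leq _ (1 + (duration c2 + 1))); first lia.
  apply: reaches_trans sj _; apply: reaches_trans (IH2 _ m d2 m0 m1 m3 hc2) _.
  by apply: reaches_step; apply: step_jmp.
move=> dF m0 m1 m3; have dc := disciplined_for dF.
have /and4P [/and4P [b01 rb rc _] n12 _ _] := dF.
set C := compile o.+3 c; set e := (o.+3 + (size C).+2)%N.
rewrite -[compile o (For r b c)]/([:: NConst r 0] ++ [:: JLtN r b o.+3] ++ [:: Jmp e] ++ C ++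
  [:: NAdd r r 3] ++ [:: Jmp o.+1]).
move=> /code_at_cat [h1 /code_at_cat [h2 /code_at_cat [h3 /code_at_cat [h4 /code_at_cat [h5 h6]]]]].
move: h2 h3 h4 h5 h6; rewrite /= !addn1 => h2 h3 h4 h5 h6.
have -> : (o + (size (C ++ [:: NAdd r r 3; Jmp o.+1])).+3 = e)%N by rewrite size_cat /e /=; lia.
pose L k := loop (denote c) r k m.
have LE k x : (x < 20)%N -> nr (L k) x = nr m x.
  move=> x20; have [f _ _ _] := @loop_frame _ r b c (denote c) k m dF (fun m' => denote_frame m' dc).
  by apply: f; apply/negP => /(allP n12); lia.
have r20 : (20 <= r)%N by apply: (allP n12); rewrite mem_head.
have b20 : (b < 20)%N by case/orP: b01 => /eqP ->.
have bE k : nr (setN r k (L k)) b = nr m b.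
  by rewrite /= /upd eq_sym (negbTE rb) LE.
have tE k : eval_test (TLtN r b) (setN r k (L k)) = (k < nr m b)%N.
  by rewrite /eval_test bE /= /upd eqxx.
(* The machine stands at the loop test [o.+1] after [k] rounds. *)
have iter k : (k <= nr m b)%N ->
    reaches P (k * (duration c + 3) + 1) (at_pc o m) (at_pc o.+1 (setN r k (L k))).
  elim: k => [|k IHk] klt.
    by rewrite mul0n; apply: reaches_step; rewrite (step_straight m _ h1).
  apply: (@reaches_leq _ ((k * (duration c + 3) + 1) + (1 + (duration c + (1 + 1))))); first lia.
  apply: reaches_trans (IHk (ltnW klt)) _.
  apply: (reaches_trans (reaches_step (step_jump (t := TLtN r b) _ h2))).
  rewrite tE klt.
  set M := setN r k (L k).
  have ME x : (x < 20)%N -> nr M x = nr m x.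
    move=> x20; rewrite /M /= /upd; case: eqP => [xr|_]; last exact: LE.
    by move: x20; rewrite xr; lia.
  apply: (reaches_trans (IH o.+3 M dc _ _ _ _)); rewrite ?ME //.
  have [fM _ _ _] := denote_frame M dc.
  apply: (@reaches_trans _ _ _ _ (at_pc (o.+3 + size C).+1 (setN r k.+1 (L k.+1)))).
    apply: reaches_step; rewrite (@step_straight P _ _ (NAdd r r 3)) //.
    congr Some; rewrite /L /= -/(L k) -/M.
    have : nr (denote c M) r = k by rewrite fM // /M /= /upd eqxx.
    have : nr (denote c M) 3 = 1%N.
      rewrite fM ?ME //; apply/negP => h3'; have /and4P [_ /allP /(_ _ h3')] := dc; lia.
    by case: (denote c M) => N X NM XM /= -> ->; rewrite addn1.
  apply: reaches_step; apply: step_jmp; apply: code_at_eq h6; lia.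
apply: (@reaches_leq _ ((nr m b * (duration c + 3) + 1) + (1 + 1))).
  have -> : nr m b = if b == 0%N then n else K by case/orP: b01 => /eqP ->.
  by rewrite /=; lia.
apply: reaches_trans (iter _ (leqnn _)) _.
apply: (reaches_trans (reaches_step (step_jump (t := TLtN r b) _ h2))).
rewrite tE ltnn.
by apply: reaches_step; apply: step_jmp.
Qed.

End Compile.

(** The 6 of a loop absorbs the 3 per round and the 3 per loop of [duration]. This needs positive
    [n] and [K], whence the separate exit of [program] for [n = 0]. *)
Fixpoint weight (c : cmd) : nat :=
  match c with
  | Op _ => 1
  | Seq c1 c2 => weight c1 + weight c2
  | If _ c1 c2 => weight c1 + weight c2 + 2
  | For _ b c => weight c + 6
  end%N.

Fixpoint depth (b0 : nat) (c : cmd) : nat :=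
  match c with
  | Op _ => 0
  | Seq c1 c2 | If _ c1 c2 => maxn (depth b0 c1) (depth b0 c2)
  | For _ b c => (b == b0) + depth b0 c
  end%N.

Lemma duration_bound (n K : nat) (c : cmd) : (0 < n)%N -> (0 < K)%N -> wf c ->
  (duration n K c <= weight c * (n ^ depth 0 c * K ^ depth 1 c))%N.
Proof.
move=> n0 K0.
have mono a b a' b' : (a <= a')%N -> (b <= b')%N -> (n ^ a * K ^ b <= n ^ a' * K ^ b')%N.
  by move=> h1 h2; apply: leq_mul; rewrite leq_pexp2l.
have pos a b : (0 < n ^ a * K ^ b)%N by rewrite muln_gt0 !expn_gt0 n0 K0.
elim: c => [i|c1 IH1 c2 IH2|t c1 IH1 c2 IH2|r b c IH] //=.
- move=> /andP [/IH1 h1 /IH2 h2].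
  have m1 := mono (depth 0 c1) (depth 1 c1) _ _ (leq_maxl _ (depth 0 c2)) (leq_maxl _ (depth 1 c2)).
  have m2 := mono (depth 0 c2) (depth 1 c2) _ _ (leq_maxr (depth 0 c1) _) (leq_maxr (depth 1 c1) _).
  by rewrite mulnDl; apply: leq_add; [apply: leq_trans h1 _|apply: leq_trans h2 _]; rewrite leq_mul.
- move=> /andP [/IH1 h1 /IH2 h2].
  have m1 := mono (depth 0 c1) (depth 1 c1) _ _ (leq_maxl _ (depth 0 c2)) (leq_maxl _ (depth 1 c2)).
  have m2 := mono (depth 0 c2) (depth 1 c2) _ _ (leq_maxr (depth 0 c1) _) (leq_maxr (depth 1 c1) _).
  rewrite !mulnDl; apply: leq_add; last by rewrite leq_pmulr.
  by apply: leq_add; [apply: leq_trans h1 _|apply: leq_trans h2 _]; rewrite leq_mul.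
case/and4P => b01 _ _ /IH {}IH.
set M := (n ^ depth 0 c * K ^ depth 1 c)%N in IH.
set B := if b == 0%N then n else K.
have -> : (n ^ ((b == 0) + depth 0 c) * K ^ ((b == 1) + depth 1 c) = B * M)%N.
  rewrite /B /M !expnD; case/orP: b01 => /eqP -> /=; rewrite !expn1 ?expn0; ring.
have B0 : (0 < B)%N by rewrite /B; case: ifP.
have M0 : (0 < M)%N by exact: pos.
apply: (@leq_trans (B * (weight c * M + 3) + 3)); first by rewrite leq_add2r leq_mul2l leq_add2r IH orbT.
nia.
Qed.

(** * The program *)

Coercion Op : instr >-> cmd.
Notation "c1 ;; c2" := (Seq c1 c2) (at level 60, right associativity).

(* Constant registers: N0 = n, N1 = K, N2 = 0, N3 = 1, N4 = 2K, X0 = alpha, X1 = 0,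
   X2 = 1, and the row numbers of the arrays
     N5   number of successors of a job in the current set U
     N6   membership in U               N7   membership in H
     N8   sweep pointer of a chain      N9   end of a chain
     N10  best chain of a group         N11  load of U per scenario
     N12  bound l of a chain step       N13  bound t of a chain step
     N14  value of the best chain of a group.
   Variables shared by the program fragments:
     N24  has [Select] found a job      N25  the job found, X9 its [maxlate]
     N26  job whose lateness is wanted  N28  pivot scenario, N29 and N30 its rows of d and w
     N31  job a, N32 job x of the cut   N33  column of the current chain step
     N40  group, N41 its first chain    X12  bound V of the sweep, X23 bound g
     N45  is there a candidate          N46  its pivot; X26 its value, X27 its V, X28 its g. *)
Definition Nop : cmd := NConst 49 0.

Definition Loads : cmd :=
  For 20 1 (
    RConst 3 0 ;;
    For 21 0 (
      NLoad 22 6 21 ;;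
      If (TEqN 22 2) Nop (RLoad 4 20 21 ;; RAdd 3 3 4)) ;;
    RStore 11 20 3).

(* [X5 := maxlate] of job [N26] *)
Definition MaxLate : cmd :=
  RConst 5 0 ;;
  For 20 1 (
    NAdd 23 1 20 ;; RLoad 6 23 26 ;; NAdd 23 4 20 ;; RLoad 7 23 26 ;;
    RLoad 8 11 20 ;; RSub 8 8 6 ;;
    If (TLeR 8 1) Nop
      (RMul 8 7 8 ;; If (TLeR 8 5) Nop (RAdd 5 8 1))).

(* [X10 := late] of job [N26] in the pivot scenario *)
Definition PivotLate : cmd :=
  RLoad 6 29 26 ;; RLoad 7 30 26 ;; RLoad 8 11 28 ;; RSub 8 8 6 ;;
  If (TLeR 8 1) (RConst 10 0) (RMul 10 7 8).

Definition Select : cmd :=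
  NConst 24 0 ;;
  For 26 0 (
    NLoad 22 6 26 ;; If (TEqN 22 2) Nop (
    NLoad 22 5 26 ;; If (TEqN 22 2) (
    NLoad 22 7 26 ;; If (TEqN 22 2) Nop (
      MaxLate ;;
      If (TEqN 24 2)
        (NConst 24 1 ;; RAdd 9 5 1 ;; NAdd 25 26 2)
        (If (TLeR 9 5) Nop (RAdd 9 5 1 ;; NAdd 25 26 2)))) Nop)).

(** Maintained successor counts make the sink test constant-time. Input row [j + 1] holds the
    successors of [j], so column [N25] reaches all predecessors of the removed job. *)
Definition Remove : cmd :=
  NStore 6 25 2 ;;
  For 21 0 (
    NAdd 23 21 3 ;; NLoad 22 23 25 ;; NLoad 37 5 21 ;; NSub 37 37 22 ;; NStore 5 21 37).

Definition InitSet : cmd :=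
  For 21 0 (
    NStore 6 21 3 ;; NConst 37 0 ;; NAdd 23 21 3 ;;
    For 48 0 (NLoad 22 23 48 ;; NAdd 37 37 22) ;;
    NStore 5 21 37).

(** Job [a], in [N31], lies outside its cut and is thus a legitimate initial value of the
    minimum. *)
Definition MinLate : cmd :=
  NAdd 26 31 2 ;; PivotLate ;; RAdd 11 10 1 ;;
  For 26 0 (
    NLoad 22 7 26 ;;
    If (TEqN 22 2) (PivotLate ;; If (TLeR 11 10) Nop (RAdd 11 10 1)) Nop).

Definition Mark : cmd := NStore 7 26 3.
Definition Unmark : cmd := NStore 7 26 2.

Definition Direction : cmd :=
  RLoad 14 30 31 ;; RLoad 15 29 31 ;; RMul 15 14 15 ;;
  RLoad 16 30 32 ;; RLoad 17 29 32 ;; RMul 17 16 17 ;;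
  RSub 16 16 14 ;; RSub 17 17 15 ;;
  If (TLeR 16 1) (If (TLeR 1 16) (RConst 17 1) (RSub 16 1 16 ;; RSub 17 1 17)) Nop.

(** Reals can only be tested by [<=], so the strict and equal cases of [cut_test] are separated by
    testing both directions. *)
Definition Cut : cmd :=
  Direction ;;
  For 26 0 (
    RLoad 18 30 26 ;; RLoad 19 29 26 ;; RMul 19 18 19 ;;
    RSub 18 18 14 ;; RSub 19 19 15 ;; RMul 20 18 17 ;; RMul 21 19 16 ;;
    If (TLeR 21 20)
      (If (TLeR 20 21)
        (If (TLeR 18 1) (If (TLeR 1 18) (If (TLeR 19 1) Unmark Mark) Unmark) Mark)
        Unmark)
      Mark).

(** Once [Select] fails, nothing is removed any more and the remaining rounds rewrite the same entry
    of [l]; a fixed number of [n] rounds therefore does. *)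
Definition Chain : cmd :=
  InitSet ;;
  For 27 0 (
    Loads ;; MinLate ;; RStore 12 33 11 ;; Select ;;
    If (TEqN 24 2) Nop (RStore 13 33 9 ;; Remove ;; NAdd 33 33 3)).

Definition Lawler : cmd :=
  For 26 0 Mark ;; InitSet ;; RConst 12 0 ;;
  For 27 0 (Loads ;; Select ;; If (TLeR 9 12) Nop (RAdd 12 9 1) ;; Remove).

(** Indices cannot be multiplied: [N34] counts the chains while [N35] accumulates [n] columns per
    chain. *)
Definition Tables : cmd :=
  NConst 34 0 ;; NConst 35 0 ;;
  For 31 0 (For 32 0 (
    Cut ;; NAdd 33 35 2 ;; Chain ;;
    NStore 8 34 35 ;; NStore 9 34 33 ;; NAdd 34 34 3 ;; NAdd 35 35 0)).

(** An advance changes the head of one chain only, so rescanning its group of [n] chains restores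
    the group maxima. *)
Definition Regroup : cmd :=
  NLoad 22 8 41 ;; RLoad 22 12 22 ;; NAdd 39 41 2 ;; NAdd 38 41 2 ;;
  For 32 0 (
    NLoad 22 8 38 ;; RLoad 23 12 22 ;;
    If (TLeR 23 22) Nop (RAdd 22 23 1 ;; NAdd 39 38 2) ;;
    NAdd 38 38 3) ;;
  RStore 14 40 22 ;; NStore 10 40 39.

Definition PickGroup : cmd :=
  RLoad 23 14 2 ;; NConst 40 0 ;; NConst 41 0 ;; NConst 36 0 ;;
  For 31 0 (
    RLoad 22 14 31 ;;
    If (TLeR 22 23) Nop (RAdd 23 22 1 ;; NAdd 40 31 2 ;; NAdd 41 36 2) ;;
    NAdd 36 36 0).

Definition UpdateBest : cmd :=
  NConst 45 1 ;; RAdd 26 24 1 ;; RAdd 27 12 1 ;; RAdd 28 23 1 ;; NAdd 46 28 2.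

Definition RecordBest : cmd :=
  RMul 24 0 12 ;; RSub 25 2 0 ;; RMul 25 25 23 ;; RAdd 24 24 25 ;;
  If (TEqN 45 2) UpdateBest (If (TLeR 26 24) Nop UpdateBest).

Definition Advance : cmd :=
  NLoad 34 10 40 ;; NLoad 33 8 34 ;; NLoad 37 9 34 ;;
  If (TLtN 33 37)
    (RLoad 24 13 33 ;; If (TLeR 24 12) Nop (RAdd 12 24 1) ;;
     NAdd 33 33 3 ;; NStore 8 34 33 ;; Regroup)
    Nop.

Definition AllGroups : cmd := NConst 41 0 ;; For 40 0 (Regroup ;; NAdd 41 41 0).

(** The three nested loops are merely a counter up to [n ^ 3]. *)
Definition Sweep : cmd :=
  AllGroups ;;
  For 42 0 (For 43 0 (For 44 0 (PickGroup ;; RecordBest ;; Advance))).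

Definition Cap : cmd := For 26 0 (PivotLate ;; If (TLeR 10 28) Mark Unmark).

Definition SetPivot : cmd := NAdd 29 1 28 ;; NAdd 30 4 28.

(** Only the pivot and the bound g of the winner are used: among the sinks that g allows, the one of
    least [maxlate] respects V by attainability. Row 0 is filled from the last position
    downwards. *)
Definition Output : cmd :=
  NAdd 28 46 2 ;; SetPivot ;; InitSet ;; NAdd 47 0 2 ;;
  For 27 0 (
    Loads ;; Cap ;; Select ;; Remove ;; NSub 47 47 3 ;; NStore 2 47 25).

Definition Optimize : cmd := For 28 1 (SetPivot ;; Lawler ;; Tables ;; Sweep).

Definition Main : cmd := Optimize ;; Output.

Definition prelude : seq instr :=
  [:: NConst 3 1; NAdd 4 1 1; NAdd 5 0 3; NAdd 6 5 3; NAdd 7 6 3; NAdd 8 7 3;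
      NAdd 9 8 3; NAdd 10 9 3; NAdd 11 4 1; NAdd 12 11 3; NAdd 13 12 3;
      NAdd 14 13 3; RConst 2 1].

(** [N2] is initially 0, so an empty instance jumps past the end of the code, where the machine
    stops. *)
Definition link (code : seq instr) : seq instr :=
  JEqN 0 2 (size prelude + size code).+1 :: prelude ++ code.

Definition program : seq instr := link (compile (size prelude).+1 Main).

Lemma code_at_link code : [/\ code_at (link code) 0 [:: jump (TEqN 0 2) (size (link code))],
  code_at (link code) 1 prelude & code_at (link code) (size prelude).+1 code].
Proof.
have : code_at (link code) 0 (link code) by [].
rewrite {2}/link -cat1s => /code_at_cat [h1 /code_at_cat [h2 h3]].
by split; rewrite // /jump [size (link _)]/= size_cat.
Qed.

Lemma size_link code : size (link code) = ((size prelude).+1 + size code)%N.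
Proof. by []. Qed.

Lemma run_end (R : realFieldType) P f (m : store R) :
  run P f (at_pc (size P) m) = Some (at_pc (size P) m).
Proof. by case: f => [|f]; rewrite /= /step leqnn. Qed.

(** * Correctness of the program *)

Ltac unroll := repeat match goal with
  | |- context [sem (Seq ?a ?b) ?m] => rewrite (sem_seq a b m)
  | |- context [sem (Op ?i) ?m] => rewrite (sem_op i m)
  | |- context [sem (If ?t ?a ?b) ?m] => rewrite (sem_if t a b m)
  | |- context [sem Nop ?m] => rewrite (sem_op (NConst 49 0) m : sem Nop m = _)
  end.

Ltac for_inv I :=
  match goal with |- context [@sem ?R (For ?r ?b ?c) ?m] =>
    case: (@forP R r b c m I isT); cbv beta end.

Section Specs.
Variables (R : realFieldType) (n K : nat) (prec : nat -> nat -> bool).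
Variables (p d w : nat -> nat -> R) (alpha : R).
Hypothesis prec_spo : strict_partial_order n prec.
Hypothesis data_ge0 : forall i j, (i < K)%N -> (j < n)%N ->
  0 <= p i j /\ 0 <= d i j /\ 0 <= w i j.

Local Notation sink := (sink n prec).
Local Notation late := (late n p d w).
Local Notation load := (load n p).
Local Notation maxlate := (maxlate n K p d w).
Local Notation maxcost := (maxcost K p d w).
Local Notation store := (store R).
Local Notation chain := (chain n K prec p d w).
Local Notation is_minlate := (is_minlate n p d w).
Local Notation chain_table := (chain_table n K prec p d w).
Local Notation barred := (barred n prec).
Local Notation attainable := (attainable n K prec p d w).

(** Input occupies rows 1 to [n] of the natural memory and the rows below [3 * K] of the real one;
    working arrays start right after. Register 2, holding 0, doubles as the name of the output
    row. *)
Definition nrow (a : nat) : nat := if a == 2%N then 0%N else (n + a - 4)%N.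
Definition rrow (a : nat) : nat := (3 * K + a - 11)%N.
Arguments nrow : simpl never.
Arguments rrow : simpl never.

Definition narr : seq nat := [:: 2; 5; 6; 7; 8; 9; 10]%N.
Definition xarr : seq nat := [:: 11; 12; 13; 14]%N.

Record env (m : store) : Prop := Env {
  env_n : nr m 0 = n;
  env_K : nr m 1 = K;
  env_1 : nr m 3 = 1%N;
  env_2K : nr m 4 = (2 * K)%N;
  env_narr : forall a, a \in narr -> nr m a = nrow a;
  env_xarr : forall a, a \in xarr -> nr m a = rrow a;
  env_alpha : xr m 0 = alpha;
  env_x0 : xr m 1 = 0;
  env_x1 : xr m 2 = 1;
  env_prec : forall j y, (j < n)%N -> (y < n)%N -> nm m j.+1 y = prec j y;
  env_p : forall i j, (i < K)%N -> (j < n)%N -> xm m i j = p i j;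
  env_d : forall i j, (i < K)%N -> (j < n)%N -> xm m (K + i) j = d i j;
  env_w : forall i j, (i < K)%N -> (j < n)%N -> xm m (2 * K + i) j = w i j }.

(** Stores go only through registers naming working arrays or the output, so the input survives. *)
Definition confined (c : cmd) : bool :=
  [&& disciplined c, all [in narr] (nstores c) & all [in xarr] (rstores c)].

Lemma env_cframe c (m m' : store) : env m -> cframe c m m' -> confined c -> env m'.
Proof.
move=> e [f1 f2 f3 f4] /and3P [dc nc xc].
have /and4P [_ /allP n20 /allP x3 _] := dc.
have g1 x : (x < 20)%N -> nr m' x = nr m x.
  by move=> h; apply: f1; apply/negP => /n20; lia.
have g2 x : (x < 3)%N -> xr m' x = xr m x.
  by move=> h; apply: f2; apply/negP => /x3; lia.
have narr20 a : a \in narr -> (a < 20)%N by rewrite /narr /xarr !inE; lia.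
have xarr20 a : a \in xarr -> (a < 20)%N by rewrite /narr /xarr !inE; lia.
have g3 j y : (j < n)%N -> nm m' j.+1 y = nm m j.+1 y.
  move=> jn; apply: f3; apply/negP => /mapP [a /(allP nc) /= an].
  rewrite (env_narr e) // /nrow; move: an; rewrite /narr !inE => h; case: eqP; lia.
have g4 i y : (i < 3 * K)%N -> xm m' i y = xm m i y.
  move=> iK; apply: f4; apply/negP => /mapP [a /(allP xc) /= an].
  rewrite (env_xarr e) // /rrow; move: an; rewrite /narr /xarr !inE; lia.
case: e => *; split; rewrite ?g1 ?g2 //.
- by move=> a h; rewrite g1 ?narr20 //; auto.
- by move=> a h; rewrite g1 ?xarr20 //; auto.
- by move=> j y jn yn; rewrite g3 //; auto.
- by move=> i j iK jn; rewrite g4; [auto|lia].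
- by move=> i j iK jn; rewrite g4; [auto|lia].
- by move=> i j iK jn; rewrite g4; [auto|lia].
Qed.

Lemma env_setN m r v : env m -> (20 <= r)%N -> env (setN r v m).
Proof.
move=> e r20; have h x : (x < 20)%N -> nr (setN r v m) x = nr m x.
  by rewrite /= /upd; case: eqP => // ->; lia.
case: e => *; split=> //; rewrite ?h // => a ain.
- by rewrite h; [auto|move: ain; rewrite /narr /xarr !inE; lia].
- by rewrite h; [auto|move: ain; rewrite /narr /xarr !inE; lia].
Qed.

Lemma envE m : env m ->
  ((nr m 0 = n) * (nr m 1 = K) * (nr m 2 = 0%N) * (nr m 3 = 1%N) * (nr m 4 = 2 * K)%N) *
  ((nr m 5 = nrow 5) * (nr m 6 = nrow 6) * (nr m 7 = nrow 7) * (nr m 8 = nrow 8) *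
   (nr m 9 = nrow 9) * (nr m 10 = nrow 10)) *
  ((nr m 11 = rrow 11) * (nr m 12 = rrow 12) * (nr m 13 = rrow 13) * (nr m 14 = rrow 14)) *
  ((xr m 0 = alpha) * (xr m 1 = 0) * (xr m 2 = 1)).
Proof.
by move=> e; do !split; first [by case: e | by apply: (env_narr e) | by apply: (env_xarr e)].
Qed.

Lemma env_same m m' : env m -> nm m' = nm m -> xm m' = xm m ->
  (forall x, (x < 20)%N -> nr m' x = nr m x) -> (forall x, (x < 3)%N -> xr m' x = xr m x) ->
  env m'.
Proof.
case=> ? ? ? ? hn hx ? ? ? ? ? ? ? nmE xmE nrE xrE; split; rewrite ?nmE ?xmE ?nrE ?xrE //.
- by move=> a ha; rewrite nrE ?hn //; move: ha; rewrite /narr !inE; lia.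
- by move=> a ha; rewrite nrE ?hx //; move: ha; rewrite /xarr !inE; lia.
Qed.

Lemma env_sem c m : env m -> confined c -> env (sem c m).
Proof.
move=> e cc; have /and3P [dc _ _] := cc.
exact: env_cframe (sem_frame m dc) cc.
Qed.

Lemma env_exec i m : env m -> confined (Op i) -> env (exec_op i m).
Proof. by rewrite -sem_op; exact: env_sem. Qed.

Lemma keepN c (m m' : store) x : cframe c m m' -> x \notin nwrites c -> nr m' x = nr m x.
Proof. by case=> h _ _ _; apply: h. Qed.

Lemma keepX c (m m' : store) x : cframe c m m' -> x \notin rwrites c -> xr m' x = xr m x.
Proof. by case=> _ h _ _; apply: h. Qed.

Lemma keepNM c (m m' : store) a z : env m -> cframe c m m' ->
  [&& a \in narr, a \notin nstores c & all [in narr] (nstores c)] ->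
  nm m' (nrow a) z = nm m (nrow a) z.
Proof.
move=> e [_ _ h _] /and3P [an ac nc]; apply: h; apply: contra ac.
case/mapP => b bc ab; suff -> : a = b by [].
have bn : b \in narr := allP nc b bc.
move: ab; rewrite (env_narr e) // /nrow; move: an bn; rewrite /narr !inE; case: (a =P 2%N) => ?; case: (b =P 2%N) => ?; lia.
Qed.

Lemma keepXM c (m m' : store) a z : env m -> cframe c m m' ->
  [&& a \in xarr, a \notin rstores c & all [in xarr] (rstores c)] ->
  xm m' (rrow a) z = xm m (rrow a) z.
Proof.
move=> e [_ _ _ h] /and3P [an ac nc]; apply: h; apply: contra ac.
case/mapP => b bc ab; suff -> : a = b by [].
have bn : b \in xarr := allP nc b bc.
move: ab; rewrite (env_xarr e) // /rrow; move: an bn; rewrite /narr /xarr !inE; lia.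
Qed.

Arguments keepN {c m m'} x.
Arguments keepX {c m m'} x.
Arguments keepNM {c m m'} a {z}.
Arguments keepXM {c m m'} a {z}.

(** * Evaluation, selection and removal of jobs *)

Definition inU (m : store) : pred nat := fun z => nm m (nrow 6) z != 0%N.
Definition inH (m : store) : pred nat := fun z => nm m (nrow 7) z != 0%N.
Definition cur (m : store) (i : nat) : R := xm m (rrow 11) i.

Lemma Loads_spec m i : env m -> (i < K)%N -> cur (sem Loads m) i = load i (inU m).
Proof.
move=> e iK; rewrite /Loads.
for_inv (fun i (m' : store) => forall i', (i' < i)%N -> cur m' i' = load i' (inU m))
    => [//|i1 m1 i1K f1 I1|m' [f I ->]].
  rewrite (envE e) in i1K; have e1 := env_cframe e f1 isT.
  unroll; set M := exec_op (RConst 3 0) _.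
  have eM : env M by rewrite /M; apply: env_exec (env_setN _ e1 _) _.
  for_inv (fun j (m' : store) => xr m' 3 = \sum_(0 <= j' < j | inU m j') p i1 j')
    => [||m2 [f2 I2 ->]].
  + by rewrite /M big_geq.
  + move=> j m2; rewrite (envE eM) => jn f2 I2; have e2 := env_cframe eM f2 isT.
    unroll; rewrite big_mkcond /= big_nat_recr //= -big_mkcond /= -I2 /upd /=.
    rewrite !(envE e2) /=.
    have -> : nm m2 (nrow 6) j = nm m (nrow 6) j.
      by rewrite (keepNM 6 eM f2 isT) /M /= (keepNM 6 e f1 isT).
    rewrite -/(inU m j) /inU; case: eqP => _ /=; first by rewrite addr0.
    by rewrite (keepN 20 f2 isT) /M /= /upd /= (env_p e2).
  rewrite (envE eM) in I2 *; have e2 := env_cframe eM f2 isT.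
  move=> i' i'lt; unroll; rewrite /cur /= /upd /upd2 /= !(envE e2) eqxx /=.
  rewrite (keepN 20 f2 isT) /M /= /upd /= I2.
  case: eqP => [->//|ne].
  rewrite (keepXM 11 eM f2 isT) [LHS](I1 i') //; lia.
by rewrite (envE e) in I *; rewrite [LHS](I i).
Qed.

Lemma MaxLate_spec m (U : pred nat) z : env m -> nr m 26 = z -> (z < n)%N ->
  (forall i, (i < K)%N -> cur m i = load i U) ->
  xr (sem MaxLate m) 5 = maxlate z U.
Proof.
move=> e z26 zn curE; rewrite /MaxLate sem_seq sem_op; set M := exec_op _ m.
have eM : env M by rewrite /M; apply: env_exec e _.
for_inv (fun i (m' : store) => xr m' 5 = \big[Num.max/0]_(0 <= i' < i) late i' z U)
  => [|i m1|m1 [f1 I1 ->]].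
- by rewrite /M big_geq.
- rewrite (envE eM) => iK f1 I1; have e1 := env_cframe eM f1 isT.
  have z1 : nr m1 26 = z by rewrite (keepN 26 f1 isT).
  rewrite bigmax_nat_recr; move: I1; set S := \big[_/_]_(_ <= _ < _) _ => I1.
  have S0 : 0 <= S by exact: bigmax_seq_ge0.
  unroll; rewrite /= /upd /= !(envE e1) z1.
  rewrite (env_d e1) // (env_w e1) // I1.
  have -> : xm m1 (rrow 11) i = load i U.
    by rewrite (keepXM 11 eM f1 isT) [LHS]curE.
  have [_ [_ w0]] := data_ge0 iK zn.
  rewrite /late; case: ifP => [le0|].
    by rewrite /= I1 max_l // max_l // mulr0.
  move=> /negbT; rewrite -ltNge => gt0; rewrite [Num.max 0 _]max_r; last exact: ltW.
  rewrite addr0; case: ifP => [le|/negbT]; rewrite /=; first by rewrite I1 max_l.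
  by rewrite -ltNge => /ltW /max_r.
- by rewrite /= I1 (envE eM).
Qed.

Lemma PivotLate_spec m (U : pred nat) k z : env m ->
  nr m 28 = k -> nr m 29 = (K + k)%N -> nr m 30 = (2 * K + k)%N -> (k < K)%N ->
  nr m 26 = z -> (z < n)%N -> cur m k = load k U ->
  xr (sem PivotLate m) 10 = late k z U.
Proof.
move=> e r28 r29 r30 kK z26 zn curE.
rewrite /PivotLate; unroll; rewrite /= /upd /= r28 r29 r30 z26 !(envE e).
rewrite (env_d e) // (env_w e) // -[xm m _ _]/(cur m k) curE /late.
case: ifP => [le0|/negbT] /=; first by rewrite max_l // mulr0.
by rewrite -ltNge => /ltW h; rewrite max_r.
Qed.

Definition cnt_ok (m : store) : Prop := forall z, (z < n)%N ->
  nm m (nrow 5) z = (\sum_(0 <= y < n | inU m y) prec z y)%N.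

Lemma cnt_sink m z : cnt_ok m -> (z < n)%N -> inU m z ->
  (nm m (nrow 5) z == 0%N) <-> sink (inU m) z.
Proof.
move=> cm zn Uz; rewrite cm // sum_nat_seq_eq0; split.
  move=> /allP h; split=> // y yn Uy; have := h y.
  by rewrite mem_index_iota => /(_ yn); rewrite Uy /= eqb0.
move=> [_ _ h]; apply/allP => y; rewrite mem_index_iota => /= yn.
by apply/implyP => Uy; rewrite eqb0; apply: h.
Qed.

Definition selected (m0 m : store) (i : nat) : Prop :=
  (nr m 24 = 0%N /\ forall y, (y < i)%N -> sink (inU m0) y -> ~~ inH m0 y) \/
  (nr m 24 = 1%N /\ exists z, [/\ nr m 25 = z, sink (inU m0) z, inH m0 z,
      xr m 9 = maxlate z (inU m0) &
      forall y, (y < i)%N -> sink (inU m0) y -> inH m0 y ->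
        maxlate z (inU m0) <= maxlate y (inU m0)]).

Lemma Select_spec m : env m -> cnt_ok m ->
  (forall i, (i < K)%N -> cur m i = load i (inU m)) ->
  selected m (sem Select m) n.
Proof.
move=> e cm curE; rewrite /Select sem_seq sem_op; set M := exec_op _ m.
have eM : env M by rewrite /M; apply: env_exec e _.
for_inv (fun i (m' : store) => selected m m' i) => [|i m1|m1 [f1 I1 ->]]; last first.
- by move: I1; rewrite (envE eM).
- rewrite (envE eM) => iN f1 I1; have e1 := env_cframe eM f1 isT.
  unroll; rewrite /= /upd /= !(envE e1) /=.
  have skip m2 : nr m2 24 = nr m1 24 -> nr m2 25 = nr m1 25 -> xr m2 9 = xr m1 9 ->
      ~ (sink (inU m) i /\ inH m i) -> selected m m2 i.+1.
    rewrite /selected => -> -> -> ni; case: I1 => [[-> h]|[-> [z [h1 h2 h3 h4 h5]]]].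
      left; split=> // y; rewrite ltnS leq_eqVlt => /orP [/eqP ->|]; last exact: h.
      by move=> si; apply/negP => Hi; apply: ni.
    right; split=> //; exists z; split=> // y; rewrite ltnS leq_eqVlt => /orP [/eqP ->|]; last exact: h5.
    by move=> si Hi; case: ni.
  have -> : (nm m1 (nrow 6) i == 0%N) = ~~ inU m i.
    by rewrite /inU negbK (keepNM 6 eM f1 isT).
  have -> : (nm m1 (nrow 7) i == 0%N) = ~~ inH m i.
    by rewrite /inH negbK (keepNM 7 eM f1 isT).
  have -> : nm m1 (nrow 5) i = nm m (nrow 5) i.
    by rewrite (keepNM 5 eM f1 isT).
  case: (boolP (inU m i)) => Ui /=; last first.
    by apply: skip => //= -[[_ h _] _]; rewrite h in Ui.
  have cs := cnt_sink cm iN Ui.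
  case: (nm m (nrow 5) i =P 0%N) => ci; last first.
    by apply: skip => //= -[/cs /eqP].
  have si : sink (inU m) i by apply/cs/eqP.
  case: (boolP (inH m i)) => Hi /=; last by apply: skip => //= -[_ h]; rewrite h in Hi.
  set M2 := Store _ _ _ _.
  have eM2 : env M2.
    by apply: (env_same e1) => // x x20; rewrite /M2 /=; do ?[case: eqP => [xE|_]; first by rewrite xE in x20].
  have mlE : xr (sem MaxLate M2) 5 = maxlate i (inU m).
    apply: MaxLate_spec => // i' i'K; rewrite -[RHS]curE //.
    by rewrite /cur (keepXM 11 eM f1 isT).
  have fM := @sem_frame R MaxLate M2 isT; have eM3 := env_cframe eM2 fM isT.
  rewrite mlE /= (keepX 9 fM isT) (keepN 24 fM isT) (keepN 26 fM isT) /= /upd /=.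
  rewrite !(envE eM3) /= addr0 addn0.
  case: I1 => [[h1 h2]|[h1 [z [h2 h3 h4 h5 h6]]]]; rewrite h1 /=.
    right; split=> //; exists i; split=> // y; rewrite ltnS leq_eqVlt => /orP [/eqP ->//|yi] ys yH.
    by have := h2 _ yi ys; rewrite yH.
  rewrite h5; case: ifP => [le|/negbT]; rewrite /=.
    right; split; first by rewrite /= (keepN 24 fM isT).
    exists z; split=> //=.
    + by rewrite (keepN 25 fM isT).
    + by rewrite (keepX 9 fM isT).
    + move=> y; rewrite ltnS leq_eqVlt => /orP [/eqP ->//|]; exact: h6.
  rewrite -ltNge => lt; right; split; first by rewrite /= (keepN 24 fM isT).
  exists i; split=> //= y; rewrite ltnS leq_eqVlt => /orP [/eqP ->//|yi] ys yH.
  exact: le_trans (ltW lt) (h6 _ yi ys yH).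
- by left.
Qed.

Lemma Remove_spec m z : env m -> cnt_ok m -> nr m 25 = z -> (z < n)%N -> inU m z ->
  let m' := sem Remove m in
  cnt_ok m' /\ forall j, inU m' j = inU m j && (j != z).
Proof.
move=> e cm z25 zn Uz /=; rewrite /Remove sem_seq sem_op; set M := exec_op _ m.
have eM : env M by rewrite /M; apply: env_exec e _.
have UM j : inU M j = inU m j && (j != z).
  rewrite /inU /M /= /upd2 !(envE e) z25 eqxx /=.
  by case: (j == z) => /=; rewrite ?andbF ?andbT.
have cM j : nm M (nrow 5) j = nm m (nrow 5) j.
  exact: (keepNM 5 e (exec_op_frame (NStore 6 25 2) m) isT).
for_inv (fun i (m' : store) => forall j, (j < n)%N ->
    nm m' (nrow 5) j = (nm m (nrow 5) j - (if (j < i)%N then (prec j z : nat) else 0))%N)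
  => [|i m1|m1 [f1 I1 ->]].
- by move=> j jn; rewrite subn0 cM.
- rewrite (envE eM) => iN f1 I1 j jn; have e1 := env_cframe eM f1 isT.
  unroll; rewrite /= /upd /= /upd2 /= !(envE e1) eqxx /= addn1.
  rewrite (keepN 25 f1 isT) /M /= z25 (env_prec e1) //.
  case: (j =P i) => [->|ji]; first by rewrite I1 // ltnn subn0 ltnSn.
  rewrite I1 //; congr (_ - (if _ then _ else _))%N; lia.
have e1 := env_cframe eM f1 isT.
have Um1 j : inU (setN 21 (nr M 0) m1) j = inU m j && (j != z).
  by rewrite -UM /inU /= (keepNM 6 eM f1 isT).
split=> // j jn; rewrite /= I1 // (envE eM) jn cm //.
rewrite [RHS](eq_bigl (fun y => inU m y && (y != z))); last exact: Um1.
rewrite (big_mkcond (inU m)) (bigD1_seq z) ?iota_uniq ?mem_index_iota //= Uz addKn.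
by rewrite -big_mkcondr; apply: eq_bigl => y; rewrite andbC.
Qed.

Lemma InitSet_spec m : env m -> let m' := sem InitSet m in
  cnt_ok m' /\ forall j, (j < n)%N -> inU m' j.
Proof.
move=> e /=; rewrite /InitSet.
for_inv (fun i (m' : store) => forall j, (j < i)%N -> nm m' (nrow 6) j = 1%N /\
    nm m' (nrow 5) j = (\sum_(0 <= y < n) prec j y)%N) => [//|i m1|m1 [f1 I1 ->]].
  rewrite (envE e) => iN f1 I1; have e1 := env_cframe e f1 isT.
  unroll; set M := exec_op (NAdd 23 21 3) _.
  have eM : env M by rewrite /M; do 3 apply: env_exec => //; apply: env_setN.
  for_inv (fun i' (m' : store) => nr m' 37 = (\sum_(0 <= y < i') prec i y)%N) => [|i2 m2|m2 [f2 I2 ->]].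
  - by rewrite /M big_geq.
  - rewrite (envE eM) => i2n f2 I2; have e2 := env_cframe eM f2 isT.
    unroll; rewrite /= /upd /= I2 big_nat_recr //= (keepN 23 f2 isT) /M /= /upd /=.
    by rewrite (envE e1) addn1 (env_prec e2).
  have e2 := env_cframe eM f2 isT; rewrite (envE eM) in I2 *.
  move=> j ji; unroll; rewrite /= /upd /= /upd2 /= !(envE e2) eqxx I2.
  rewrite (keepN 21 f2 isT) /M /= /upd /=.
  have -> : (nrow 6 == nrow 5) = false by rewrite /nrow /=; lia.
  rewrite /= (keepNM 6 eM f2 isT) /M /= /upd /= /upd2 /= !(envE e1) eqxx.
  case: (j =P i) => [->//|ne]; rewrite (keepNM 5 eM f2 isT) /M /= /upd2.
  have -> : (nrow 5 == nr m1 6) = false by rewrite !(envE e1) /nrow /=; lia.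
  by apply: I1; lia.
rewrite (envE e) in I1 *.
have Uj j : (j < n)%N -> inU (setN 21 n m1) j by move=> /I1 [h _]; rewrite /inU /= h.
split=> // z zn; rewrite /= (I1 z zn).2 [RHS]big_mkcond.
by apply: eq_big_nat => y /Uj ->.
Qed.

(** * Cuts and the tables of their chains *)

Definition pivot (m : store) (k : nat) : Prop :=
  [/\ nr m 28 = k, nr m 29 = (K + k)%N, nr m 30 = (2 * K + k)%N & (k < K)%N].

Definition piv_cut (k a x : nat) : pred nat := cut (w k) (fun z => w k z * d k z) a x.

Lemma pivot_cframe c m m' k : pivot m k -> cframe c m m' ->
  [&& 28 \notin nwrites c, 29 \notin nwrites c & 30 \notin nwrites c]%N -> pivot m' k.
Proof.
by case=> h1 h2 h3 kK f /and3P [n1 n2 n3]; split; rewrite ?(keepN _ f).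
Qed.

Lemma pivot_late m (U : pred nat) k z : env m -> pivot m k ->
  nr m 26 = z -> (z < n)%N -> cur m k = load k U ->
  xr (sem PivotLate m) 10 = late k z U.
Proof. by move=> e [? ? ? ?] *; apply: (PivotLate_spec e). Qed.

Lemma MinLate_spec m (U : pred nat) k a : env m -> pivot m k ->
  nr m 31 = a -> (a < n)%N -> ~~ inH m a -> cur m k = load k U ->
  is_minlate k (inH m) U (xr (sem MinLate m) 11).
Proof.
move=> e pk a31 an nHa curE; rewrite /MinLate sem_seq sem_op; set M := exec_op _ m.
have eM : env M by rewrite /M; apply: env_exec e _.
have M26 : nr M 26 = a by rewrite /M /= /upd /= a31 !(envE e) addn0.
have late0 := pivot_late eM pk M26 an curE.
rewrite 2!sem_seq sem_op; set M1 := sem PivotLate M in late0 *.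
have f1 := @sem_frame R PivotLate M isT; have e1 := env_cframe eM f1 isT.
set M2 := exec_op _ M1.
have e2 : env M2 by rewrite /M2; apply: env_exec e1 _.
have l2 : xr M2 11 = late k a U by rewrite /M2 /= /upd /= !(envE e1) addr0.
for_inv (fun i (m' : store) =>
    (forall y, (y < i)%N -> ~~ inH m y -> xr m' 11 <= late k y U) /\
    (exists y, [/\ (y < n)%N, ~~ inH m y & xr m' 11 = late k y U]))
  => [|i m1|m1 [f [I1 I2] ->]]; last first.
- by move: I1; rewrite (envE e2).
- rewrite (envE e2) => iN f [I1 I2]; have em := env_cframe e2 f isT.
  unroll; set m2 := exec_op _ _.
  have em2 : env m2 by rewrite /m2; apply: env_exec (env_setN _ em _) _.
  have -> : eval_test (TEqN 22 2) m2 = ~~ inH m i.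
    rewrite /m2 /= /upd /= !(envE em) /inH negbK (keepNM 7 e2 f isT).
    by rewrite /= (keepNM 7 eM f1 isT).
  case: (boolP (inH m i)) => Hi /=.
    split=> // y; rewrite ltnS leq_eqVlt => /orP [/eqP ->|]; [by rewrite Hi|exact: I1].
  have pk1 : pivot M1 k := pivot_cframe (pk : pivot M k) f1 isT.
  have pk2 : pivot m2 k := pivot_cframe (pk1 : pivot M2 k) f isT.
  have cur2 : cur m2 k = load k U.
    by rewrite -curE /cur /m2 /= (keepXM 11 e2 f isT) /= (keepXM 11 eM f1 isT).
  have i26 : nr m2 26 = i by [].
  have lateE := pivot_late em2 pk2 i26 iN cur2.
  have f3 := @sem_frame R PivotLate m2 isT; have e3 := env_cframe em2 f3 isT.
  rewrite (keepX 11 f3 isT) lateE /= !(envE e3).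
  case: I2 => y0 [y0n Hy0 y0E].
  case: ifP => [le|/negbT]; rewrite /= /upd /=.
    rewrite (keepX 11 f3 isT) /=; split; last by exists y0.
    by move=> y; rewrite ltnS leq_eqVlt => /orP [/eqP ->//|]; exact: I1.
  rewrite -ltNge addr0 => lt; split; last by exists i.
  move=> y; rewrite ltnS leq_eqVlt => /orP [/eqP ->//|yi] Hy.
  exact: le_trans (ltW lt) (I1 y yi Hy).
- by split=> //; exists a.
Qed.

Lemma Direction_spec m k a x : env m -> pivot m k ->
  nr m 31 = a -> (a < n)%N -> nr m 32 = x -> (x < n)%N ->
  let m' := sem Direction m in
  let AB := norm_dir (w k x - w k a) (w k x * d k x - w k a * d k a) in
  [/\ xr m' 14 = w k a, xr m' 15 = w k a * d k a, xr m' 16 = AB.1 & xr m' 17 = AB.2].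
Proof.
move=> e [r28 r29 r30 kK] a31 an x32 xn /=; rewrite /Direction; unroll.
rewrite /= /upd /= r29 r30 a31 x32 !(env_w e) // !(env_d e) // !(envE e) /norm_dir.
by case: ltgtP => h /=; rewrite ?sub0r ?h.
Qed.

Lemma Cut_spec m k a x : env m -> pivot m k ->
  nr m 31 = a -> (a < n)%N -> nr m 32 = x -> (x < n)%N ->
  forall z, (z < n)%N -> inH (sem Cut m) z = piv_cut k a x z.
Proof.
move=> e pk a31 an x32 xn; rewrite /Cut /Mark /Unmark sem_seq.
have [] := Direction_spec e pk a31 an x32 xn.
have f1 := @sem_frame R Direction m isT; have e1 := env_cframe e f1 isT.
set M := sem Direction m in f1 e1 *; move=> M14 M15 M16 M17.
for_inv (fun i (m' : store) => forall z, (z < i)%N -> inH m' z = piv_cut k a x z)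
  => [//|i m1|m1 [f I ->]]; last by move: I; rewrite (envE e1).
rewrite (envE e1) => iN f I1; have em := env_cframe e1 f isT.
unroll.
have pkm : pivot m1 k := pivot_cframe (pivot_cframe pk f1 isT) f isT.
case: (pkm) => r28 r29 r30 kK.
rewrite /= /upd /= r29 r30 (env_w em) // (env_d em) // !(envE em).
rewrite (keepX 14 f isT) (keepX 15 f isT) (keepX 16 f isT) (keepX 17 f isT) M14 M15 M16 M17.
set AB := norm_dir _ _; set u := w k i - w k a; set e' := w k i * d k i - w k a * d k a.
have cutE : piv_cut k a x i = cut_test AB.1 AB.2 u e' by [].
have mark m' v : nm m' = upd2 (nm m1) (nrow 7) i v -> (v != 0%N) = piv_cut k a x i ->
    forall z, (z < i.+1)%N -> inH m' z = piv_cut k a x z.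
  move=> nmE vE z; rewrite /inH nmE /upd2 eqxx /=.
  by case: (z =P i) => [->//|zi] zlt; apply: I1; lia.
move: cutE; rewrite /cut_test.
case: (ltgtP (u * AB.2) (e' * AB.1)) => [h1|h1|h1] /= cutE.
- by apply: (@mark _ 1%N); rewrite ?cutE //= ?(envE em).
- by apply: (@mark _ 0%N); rewrite ?cutE //= ?(envE em).
move: cutE; case: (ltgtP u 0) => [h2|h2|h2] /= cutE.
- by apply: (@mark _ 0%N); rewrite ?cutE //= ?(envE em).
- by apply: (@mark _ 1%N); rewrite ?cutE //= ?(envE em).
move: cutE; case: (ltP 0 e') => h3 /= cutE.
- by apply: (@mark _ 1%N); rewrite ?cutE //= ?(envE em).
- by apply: (@mark _ 0%N); rewrite ?cutE //= ?(envE em).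
Qed.

Lemma Chain_spec m k a : env m -> pivot m k ->
  nr m 31 = a -> (a < n)%N -> ~~ inH m a ->
  let m' := sem Chain m in let base := nr m 33 in
  exists len, [/\ nr m' 33 = (base + len)%N, (len < n)%N,
    chain_table k (inH m) len (fun i => xm m' (rrow 13) (base + i)%N)
                              (fun i => xm m' (rrow 12) (base + i)%N)
    & forall c, (c < base)%N -> xm m' (rrow 12) c = xm m (rrow 12) c /\
                                xm m' (rrow 13) c = xm m (rrow 13) c].
Proof.
move=> e pk a31 an nHa /=; rewrite /Chain sem_seq.
have [cm0 Um0] := InitSet_spec e.
have f0 := @sem_frame R InitSet m isT; have e0 := env_cframe e f0 isT.
set M := sem InitSet m in cm0 Um0 f0 e0 *; set base := nr m 33.
set H := inH m.
pose L (m' : store) i := xm m' (rrow 12) (base + i)%N; pose T (m' : store) i := xm m' (rrow 13) (base + i)%N.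
(* The last clause separates the rounds that have all removed a job, [len = i], from a chain already
   stuck, whose table is complete. *)
for_inv (fun i (m1 : store) => exists U z len, [/\
    [/\ chain H U z len, (len <= i)%N & nr m1 33 = (base + len)%N],
    cnt_ok m1 /\ (forall j, (j < n)%N -> inU m1 j = U len j),
    forall c, (c < base)%N -> xm m1 (rrow 12) c = xm m (rrow 12) c /\
                              xm m1 (rrow 13) c = xm m (rrow 13) c,
    forall j, (j < len)%N -> T m1 j = maxlate (z j) (U j) /\ is_minlate k H (U j) (L m1 j)
    & len = i \/ barred H (U len) /\ is_minlate k H (U len) (L m1 len)])
  => [|i m1|m1 [f [U [z [len [[ch leni r33] _ old tl last]]]] ->]].
- exists (fun=> predT), id, 0%N; split=> //.
  + by split; [exact: chain_nil | | rewrite addn0 (keepN 33 f0 isT)].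
  + move=> c _; split; [exact: (keepXM 12 e f0 isT)|exact: (keepXM 13 e f0 isT)].
  + by left.
- rewrite (envE e0) => iN f [U [z [len [[ch leni r33] [cm1 U1] old tl last]]]].
  have e1 := env_cframe e0 f isT.
  unroll; set m2 := setN 27 i m1.
  have e2 : env m2 by apply: env_setN.
  have curE i' : (i' < K)%N -> cur (sem Loads m2) i' = load i' (inU m2).
    by move=> i'K; exact: (Loads_spec e2).
  have f3 := @sem_frame R Loads m2 isT; have e3 := env_cframe e2 f3 isT.
  set m3 := sem Loads m2 in f3 e3 curE *.
  have H3 j : inH m3 j = H j.
    by rewrite /inH (keepNM 7 e2 f3 isT) /= (keepNM 7 e0 f isT) (keepNM 7 e f0 isT).
  have pk3 : pivot m3 k := pivot_cframe (pivot_cframe (pivot_cframe pk f0 isT) f isT : pivot m2 k) f3 isT.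
  have a3 : nr m3 31 = a.
    by rewrite (keepN 31 f3 isT) /m2 /= /upd /= (keepN 31 f isT) (keepN 31 f0 isT).
  have nH3 : ~~ inH m3 a by rewrite H3.
  have kK : (k < K)%N by case: pk.
  have cur3 : cur m3 k = load k (U len).
    by rewrite curE //; apply: eq_load => j jn; rewrite -U1.
  have ml3 := MinLate_spec e3 pk3 a3 an nH3 cur3.
  have f4 := @sem_frame R MinLate m3 isT; have e4 := env_cframe e3 f4 isT.
  set m4 := sem MinLate m3 in ml3 f4 e4 *.
  set m5 := exec_op (RStore 12 33 11) m4.
  have f5 : cframe (RStore 12 33 11) m4 m5 := exec_op_frame _ _.
  have e5 := env_cframe e4 f5 isT.
  have U5 j : inU m5 j = inU m1 j.
    by rewrite /inU /m5 /= (keepNM 6 e3 f4 isT) (keepNM 6 e2 f3 isT).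
  have cm5 : cnt_ok m5.
    move=> j jn; rewrite (eq_bigl (inU m1)) -?cm1 //.
    by rewrite /m5 /= (keepNM 5 e3 f4 isT) (keepNM 5 e2 f3 isT).
  have cur5 i' : (i' < K)%N -> cur m5 i' = load i' (inU m5).
    move=> i'K; rewrite /cur (keepXM 11 e4 f5 isT) (keepXM 11 e3 f4 isT).
    by rewrite [LHS]curE //; apply: eq_load => j _; rewrite U5.
  have H5 j : inH m5 j = H j.
    by rewrite -H3 /inH /m5 /= (keepNM 7 e3 f4 isT).
  have sel := Select_spec e5 cm5 cur5.
  have f6 := @sem_frame R Select m5 isT; have e6 := env_cframe e5 f6 isT.
  set m6 := sem Select m5 in sel f6 e6 *.
  have r33' : nr m4 33 = (base + len)%N.
    by rewrite (keepN 33 f4 isT) (keepN 33 f3 isT) /m2 /= /upd /= r33.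
  have L5 c : xm m5 (rrow 12) c = if c == (base + len)%N then xr m4 11 else xm m1 (rrow 12) c.
    rewrite /m5 /= /upd2 !(envE e4) eqxx r33' /=.
    by rewrite (keepXM 12 e3 f4 isT) (keepXM 12 e2 f3 isT).
  have T5 c : xm m5 (rrow 13) c = xm m1 (rrow 13) c.
    by rewrite (keepXM 13 e4 f5 isT) (keepXM 13 e3 f4 isT) (keepXM 13 e2 f3 isT).
  have U5len j : (j < n)%N -> inU m5 j = U len j by move=> jn; rewrite U5 U1.
  have mlE : is_minlate k H (U len) (xr m4 11).
    case: ml3 => h1 [y [yn Hy yE]]; split.
      by move=> x xn Hx; apply: h1; rewrite // H3.
    by exists y; rewrite -H3.
  set m7 := exec_op (RStore 13 33 9) m6.
  have -> : eval_test (TEqN 24 2) m6 = (nr m6 24 == 0%N) by rewrite /= !(envE e6).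
  case: sel => [[-> nosink]|[-> [y [r25 sy Hy x9 ymin]]]] /=.
    exists U, z, len; split=> //.
    + split=> //; first exact: leqW.
      by rewrite /upd /= (keepN 33 f6 isT) /= r33'.
    + split; last by move=> j jn; rewrite /inU /= (keepNM 6 e5 f6 isT) -U5len.
      move=> j jn; rewrite /= (keepNM 5 e5 f6 isT) cm5 //.
      by apply: eq_bigl => j'; rewrite /inU /= (keepNM 6 e5 f6 isT).
    + move=> c cb /=; rewrite (keepXM 12 e5 f6 isT) (keepXM 13 e5 f6 isT) L5 T5.
      by case: eqP => [cE|_]; [lia | exact: old].
    + move=> j jlen; rewrite /L /T /= (keepXM 12 e5 f6 isT) (keepXM 13 e5 f6 isT) L5 T5.
      by case: eqP => [cE|_]; [lia | exact: tl].
    right; split.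
      move=> x xs; rewrite -H5; have xs5 : sink (inU m5) x by apply: eq_sink xs => j jn; rewrite U5len.
      by apply: nosink => //; case: xs.
    by rewrite /L /= (keepXM 12 e5 f6 isT) L5 eqxx.
  have sylen : sink (U len) y by apply: eq_sink sy.
  (* A sink found in [H] shows that the chain was not stuck before. *)
  case: last => [leni'|[bar _]]; last by have := bar y sylen; rewrite -H5 Hy.
  have f7 : cframe (RStore 13 33 9) m6 m7 := exec_op_frame (RStore 13 33 9) m6.
  have e7 := env_cframe e6 f7 isT.
  have [yn Uy _] := sy.
  have U7 j : inU m7 j = inU m5 j by rewrite /inU /m7 /= (keepNM 6 e5 f6 isT).
  have cm7 : cnt_ok m7.
    move=> j jn; rewrite (eq_bigl (inU m5)) // -cm5 //.
    by rewrite /m7 /= (keepNM 5 e5 f6 isT).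
  have [] := Remove_spec e7 cm7 (r25 : nr m7 25 = y) yn.
    by rewrite U7.
  have f8 := @sem_frame R Remove m7 isT; have e8 := env_cframe e7 f8 isT.
  set m8 := sem Remove m7 in f8 e8 * => cm8 U8.
  have maxE x : maxlate x (inU m5) = maxlate x (U len) by apply: eq_maxlate.
  have [||U' [z' [ch' U'E z'E z'len U'len]]] := @chain_rcons R n K prec p d w H U z len y
    (inU m8) ch sylen (etrans (esym (H5 y)) Hy).
  + move=> x sx Hx; rewrite -!maxE; apply: ymin; rewrite ?H5 //; first by case: sx.
    by apply: eq_sink sx => j jn; rewrite U5len.
  + by move=> j jn; rewrite U8 U7 U5len.
  exists U', z', len.+1; split.
  + split=> //.
    by rewrite /upd /= (keepN 33 f8 isT) /m7 /= (keepN 33 f6 isT) /= r33' !(envE e8) addn1 addnS.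
  + by rewrite U'len; split.
  + move=> c cb /=; rewrite (keepXM 12 e7 f8 isT) (keepXM 13 e7 f8 isT).
    rewrite (keepXM 12 e6 f7 isT) /m7 /= /upd2 !(envE e6) eqxx (keepN 33 f6 isT) /= r33'.
    rewrite (keepXM 12 e5 f6 isT) (keepXM 13 e5 f6 isT) L5 T5 /=.
    by case: eqP => [cE|_]; [lia | exact: old].
  + move=> j; rewrite ltnS /L /T /= (keepXM 12 e7 f8 isT) (keepXM 13 e7 f8 isT).
    rewrite (keepXM 12 e6 f7 isT) /m7 /= /upd2 !(envE e6) eqxx (keepN 33 f6 isT) /= r33'.
    rewrite (keepXM 12 e5 f6 isT) (keepXM 13 e5 f6 isT) L5 T5 /= eqn_add2l.
    rewrite leq_eqVlt => /orP [/eqP ->|jlen].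
      by rewrite eqxx z'len U'E // x9 maxE.
    by rewrite (ltn_eqF jlen) z'E // U'E ?(ltnW jlen) //; exact: tl.
  + by left; rewrite leni'.
move=> /=; rewrite (envE e0) in last leni.
(* Since [len < n], not all [n] rounds removed a job, so the stuck entry has been written. *)
have lenn := chain_len ch an nHa.
exists len; split=> //; exists U, z; case: last => [len_n|[bar ml]]; first by lia.
split=> // [j jlen|j]; first by case: (tl j jlen).
by rewrite leq_eqVlt => /orP [/eqP ->//|/tl []].
Qed.

Lemma Lawler_spec m : env m ->
  let m' := sem Lawler m in
  [/\ 0 <= xr m' 12,
      exists U z, chain predT U z n /\ forall j, (j < n)%N -> maxlate (z j) (U j) <= xr m' 12
    & forall s, feasible n prec s -> xr m' 12 <= maxcost s].
Proof.
move=> e /=; rewrite /Lawler sem_seq.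
for_inv (fun i (m' : store) => forall j, (j < i)%N -> inH m' j) => [//|i m1|m1 [f1 I1 ->]].
  rewrite (envE e) => iN f1 I1 j; rewrite ltnS /Mark sem_op.
  have e1 := env_cframe e f1 isT; rewrite /inH /= /upd /= /upd2 !(envE e1) eqxx /=.
  by case: (j =P i) => //= ne ji; apply: I1; lia.
have e1 := env_cframe e f1 isT; unroll; set m2 := setN 26 _ m1.
have e2 : env m2 by apply: env_setN.
have H2 j : (j < n)%N -> inH m2 j by move: I1; rewrite (envE e); apply.
have [cm3 U3] := InitSet_spec e2.
have f3 := @sem_frame R InitSet m2 isT; have e3 := env_cframe e2 f3 isT.
set m3 := sem InitSet m2 in cm3 U3 f3 e3 *; set M := exec_op (RConst 12 0) m3.
have fM : cframe (RConst 12 0) m3 M := exec_op_frame _ _.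
have eM := env_cframe e3 fM isT.
for_inv (fun i (m' : store) => exists U z, [/\ chain predT U z i,
    cnt_ok m' /\ (forall j, (j < n)%N -> inU m' j = U i j), 0 <= xr m' 12,
    forall j, (j < i)%N -> maxlate (z j) (U j) <= xr m' 12
    & forall s, feasible n prec s -> xr m' 12 <= maxcost s])
  => [|i m4|m4 [f [U [z [ch _ V0 tV Vopt]]] ->]].
- exists (fun=> predT), id; split=> //.
  by move=> s _; exact: bigmax_seq_ge0.
- rewrite (envE eM) => iN f [U [z [ch [cm4 U4] V0 tV Vopt]]].
  have e4 := env_cframe eM f isT; unroll; set m5 := setN 27 i m4.
  have e5 : env m5 by apply: env_setN.
  have cur6 i' : (i' < K)%N -> cur (sem Loads m5) i' = load i' (inU m5).
    by move=> i'K; exact: (Loads_spec e5).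
  have f6 := @sem_frame R Loads m5 isT; have e6 := env_cframe e5 f6 isT.
  set m6 := sem Loads m5 in f6 e6 cur6 *.
  have U6 j : inU m6 j = inU m4 j by rewrite /inU (keepNM 6 e5 f6 isT).
  have cm6 : cnt_ok m6.
    move=> j jn; rewrite (eq_bigl (inU m4)) // -cm4 //.
    by rewrite (keepNM 5 e5 f6 isT).
  have {}cur6 i' : (i' < K)%N -> cur m6 i' = load i' (inU m6).
    by move=> i'K; rewrite cur6 //; apply: eq_load => j _; rewrite U6.
  have sel := Select_spec e6 cm6 cur6.
  have f7 := @sem_frame R Select m6 isT; have e7 := env_cframe e6 f7 isT.
  set m7 := sem Select m6 in sel f7 e7 *.
  have H6 j : (j < n)%N -> inH m6 j.
    move=> jn; rewrite /inH (keepNM 7 e5 f6 isT) /= (keepNM 7 eM f isT) /=.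
    by rewrite (keepNM 7 e2 f3 isT); exact: H2.
  have U6i j : (j < n)%N -> inU m6 j = U i j by move=> jn; rewrite U6 U4.
  have V7 : xr m7 12 = xr m4 12 by rewrite (keepX 12 f7 isT) (keepX 12 f6 isT).
  case: sel => [[_ nosink]|[_ [y [r25 sy Hy x9 ymin]]]].
    have [y sy] := exists_sink prec_spo (chain_inhabited ch iN).
    have sy6 : sink (inU m6) y by apply: eq_sink sy => j jn; rewrite U6i.
    by case: (sy6) => yn _ _; have := nosink y yn sy6; rewrite H6.
  have syi : sink (U i) y by apply: eq_sink sy.
  have maxE x : maxlate x (inU m6) = maxlate x (U i) by apply: eq_maxlate.
  have ymin' x : sink (U i) x -> maxlate y (U i) <= maxlate x (U i).
    move=> sx; have sx6 : sink (inU m6) x by apply: eq_sink sx => j jn; rewrite U6i.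
    by case: (sx) => xn _ _; rewrite -!maxE; apply: ymin => //; exact: H6.
  have yopt s : feasible n prec s -> maxlate y (U i) <= maxcost s.
    by move=> fs; apply: (min_sink_le_maxcost data_ge0 fs (chain_inhabited ch iN)).
  set m8 := if _ then _ else _.
  have e8 : env m8.
    by rewrite /m8; case: ifP => _; apply: env_exec.
  have nmE : nm m8 = nm m7 by rewrite /m8; case: ifP.
  have r8 : nr m8 25 = y by rewrite -r25 /m8; case: ifP.
  have V8 : [/\ xr m4 12 <= xr m8 12, maxlate y (U i) <= xr m8 12 &
      forall s, feasible n prec s -> xr m8 12 <= maxcost s].
    rewrite /m8 [eval_test _ _]/= x9 V7 maxE; case: ifP => [le|/negbT].
      by rewrite /= V7.
    by rewrite -ltNge /= /upd /= x9 maxE !(envE e7) addr0 => /ltW.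
  have U8 j : inU m8 j = inU m6 j by rewrite /inU nmE (keepNM 6 e6 f7 isT).
  have cm8 : cnt_ok m8.
    move=> j jn; rewrite (eq_bigl (inU m6)) // -cm6 //.
    by rewrite nmE (keepNM 5 e6 f7 isT).
  have [yn Uy _] := sy.
  have [|cm9 U9] := Remove_spec e8 cm8 r8 yn; first by rewrite U8.
  have f9 := @sem_frame R Remove m8 isT; have e9 := env_cframe e8 f9 isT.
  set m9 := sem Remove m8 in f9 e9 cm9 U9 *.
  have [||U' [z' [ch' U'E z'E z'len U'len]]] := @chain_rcons R n K prec p d w predT U z i y
    (inU m9) ch syi isT.
  + by move=> x sx _; exact: ymin'.
  + by move=> j jn; rewrite U9 U8 U6i.
  case: V8 => V48 yV Vopt8; rewrite (keepX 12 f9 isT).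
  exists U', z'; split=> //.
  + by rewrite U'len.
  + exact: le_trans V0 V48.
  move=> j; rewrite ltnS leq_eqVlt => /orP [/eqP ->|ji]; first by rewrite z'len U'E.
  by rewrite z'E // U'E ?(ltnW ji) //; apply: le_trans V48; apply: tV.
move: ch tV; rewrite (envE eM) => ch tV.
by split=> //; exists U, z.
Qed.

(* Chain number [a * n + x] occupies the columns from [(a * n + x) * n] on. *)
Definition entry (k : nat) (m : store) (a x len : nat) : Prop :=
  let id := (a * n + x)%N in
  [/\ nm m (nrow 9) id = (id * n + len)%N, (len < n)%N &
    chain_table k (piv_cut k a x) len
      (fun i => xm m (rrow 13) (id * n + i)%N) (fun i => xm m (rrow 12) (id * n + i)%N)].

Lemma entry_ext k (m m' : store) a x len :
  (forall c, (c < (a * n + x).+1 * n)%N ->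
     xm m' (rrow 12) c = xm m (rrow 12) c /\ xm m' (rrow 13) c = xm m (rrow 13) c) ->
  nm m' (nrow 9) (a * n + x)%N = nm m (nrow 9) (a * n + x)%N ->
  entry k m a x len -> entry k m' a x len.
Proof.
move=> xmE nmE [h1 h2 h3]; split=> //; first by rewrite nmE.
by apply: chain_table_ext h3 => // i il; case: (xmE ((a * n + x) * n + i)%N _) => //; nia.
Qed.

Lemma pair_id_inj a x a' x' : (x < n)%N -> (x' < n)%N ->
  (a * n + x = a' * n + x')%N -> a = a' /\ x = x'.
Proof.
move=> xn x'n h; have n0 : (0 < n)%N by lia.
have aE : a = a'.
  have := congr1 (fun t => t %/ n)%N h.
  by rewrite !divnMDl // !divn_small // !addn0.
by split=> //; move: h; rewrite aE => /addnI.
Qed.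

Lemma Tables_spec m k : env m -> pivot m k ->
  let m' := sem Tables m in
  forall a x, (a < n)%N -> (x < n)%N ->
    nm m' (nrow 8) (a * n + x)%N = ((a * n + x) * n)%N /\ exists len, entry k m' a x len.
Proof.
move=> e pk /=; rewrite /Tables; unroll; set M := exec_op (NConst 35 0) _.
have eM : env M by rewrite /M; do 2 apply: env_exec => //.
pose filled (c : nat) (m' : store) :=
  [/\ nr m' 34 = c, nr m' 35 = (c * n)%N &
    forall a x, (a < n)%N -> (x < n)%N -> (a * n + x < c)%N ->
      nm m' (nrow 8) (a * n + x)%N = ((a * n + x) * n)%N /\ exists len, entry k m' a x len].
for_inv (fun i (m' : store) => filled (i * n)%N m') => [|a m1|m1 [f [_ _ I] ->]]; last first.
- move=> a x an xn; apply: I => //; rewrite (envE eM); nia.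
- rewrite (envE eM) => an f I; have e1 := env_cframe eM f isT; set M1 := setN 31 a m1.
  have eM1 : env M1 by apply: env_setN.
  for_inv (fun i (m' : store) => filled (a * n + i)%N m') => [|x m2|m2 [f2 I2 ->]]; last first.
  + by move: I2; rewrite (envE eM1) mulSn addnC.
  + rewrite (envE eM1) => xn f2 [r34 r35 I2]; have e2 := env_cframe eM1 f2 isT.
    set id := (a * n + x)%N in r34 r35 I2 *.
    unroll; set m3 := setN 32 x m2.
    have e3 : env m3 by apply: env_setN.
    have pk3 : pivot m3 k := pivot_cframe (pivot_cframe (pk : pivot M k) f isT : pivot M1 k) f2 isT.
    have a3 : nr m3 31 = a by rewrite /m3 /= /upd /= (keepN 31 f2 isT).
    have cutE := Cut_spec e3 pk3 a3 an (erefl : nr m3 32 = x) xn.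
    have f4 := @sem_frame R Cut m3 isT; have e4 := env_cframe e3 f4 isT.
    set m4 := sem Cut m3 in cutE f4 e4 *; set m5 := exec_op (NAdd 33 35 2) m4.
    have f5 : cframe (NAdd 33 35 2) m4 m5 := exec_op_frame (NAdd 33 35 2) m4.
    have e5 := env_cframe e4 f5 isT.
    have a5 : nr m5 31 = a by rewrite (keepN 31 f5 isT) (keepN 31 f4 isT).
    have base5 : nr m5 33 = (id * n)%N.
      by rewrite /m5 /= /upd /= !(envE e4) addn0 (keepN 35 f4 isT).
    have nH5 : ~~ inH m5 a by rewrite [inH _ _]cutE // /piv_cut cut_self.
    have [len [r33 lenn tab old]] := Chain_spec e5 (pivot_cframe (pivot_cframe pk3 f4 isT) f5 isT) a5 an nH5.
    have f6 := @sem_frame R Chain m5 isT; have e6 := env_cframe e5 f6 isT.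
    set m6 := sem Chain m5 in r33 tab old f6 e6 *.
    rewrite base5 in r33 tab old.
    have r34' : nr m6 34 = id by rewrite (keepN 34 f6 isT) (keepN 34 f5 isT) (keepN 34 f4 isT).
    have r35' : nr m6 35 = (id * n)%N.
      by rewrite (keepN 35 f6 isT) (keepN 35 f5 isT) (keepN 35 f4 isT).
    have ne89 : (nrow 9 == nrow 8) = false by rewrite /nrow /=; lia.
    have ne98 : (nrow 8 == nrow 9) = false by rewrite eq_sym.
    split.
    * by rewrite /= /upd /= r34' !(envE e6) addn1 addnS.
    * by rewrite /= /upd /= r35' !(envE e6) addnS mulSn addnC.
    move=> a' x' a'n x'n; rewrite addnS ltnS leq_eqVlt => /orP [/eqP idE|lt].
      have [-> ->] := pair_id_inj x'n xn idE.
      split.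
        by rewrite /= /upd /= /upd2 !(envE e6) r34' r35' ne98 !eqxx.
      exists len; split=> //.
        by rewrite /= /upd /= /upd2 !(envE e6) r34' r33 !eqxx.
      apply: chain_table_ext tab => // j jn; exact: cutE.
    have [p1 [len' ent]] := I2 a' x' a'n x'n lt.
    have neid : (a' * n + x' == id)%N = false by rewrite (ltn_eqF lt).
    split.
      rewrite /= /upd /= /upd2 !(envE e6) r34' neid !andbF.
      by rewrite (keepNM 8 e5 f6 isT) (keepNM 8 e4 f5 isT) (keepNM 8 e3 f4 isT).
    exists len'; apply: entry_ext ent.
      move=> c clt /=; have [|-> ->] := old c; first by nia.
      rewrite (keepXM 12 e4 f5 isT) (keepXM 12 e3 f4 isT).
      by rewrite (keepXM 13 e4 f5 isT) (keepXM 13 e3 f4 isT).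
    rewrite /= /upd /= /upd2 !(envE e6) r34' neid !andbF.
    by rewrite (keepNM 9 e5 f6 isT) (keepNM 9 e4 f5 isT) (keepNM 9 e3 f4 isT).
  + by case: I => h1 h2 h3; split; rewrite ?addn0.
- by split.
Qed.

(** * The sweep over the constraints *)

Definition head (m : store) (id : nat) : R := xm m (rrow 12) (nm m (nrow 8) id).

Definition grouped (m : store) (a : nat) : Prop := exists x, [/\ (x < n)%N,
  nm m (nrow 10) a = (a * n + x)%N, xm m (rrow 14) a = head m (a * n + x)%N &
  forall x', (x' < n)%N -> head m (a * n + x')%N <= xm m (rrow 14) a].

Lemma Regroup_spec m a : env m -> (0 < n)%N -> nr m 40 = a -> nr m 41 = (a * n)%N ->
  let m' := sem Regroup m in
  grouped m' a /\ forall a', a' != a -> (grouped m a' -> grouped m' a').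
Proof.
move=> e n0 r40 r41 /=; rewrite /Regroup; unroll; set M := exec_op (NAdd 38 41 2) _.
have eM : env M by rewrite /M; do 4 apply: env_exec => //.
for_inv (fun i (m' : store) => nr m' 38 = (a * n + i)%N /\ exists x, [/\ (x < n)%N,
    nr m' 39 = (a * n + x)%N, xr m' 22 = head m (a * n + x)%N &
    forall x', (x' < i)%N -> head m (a * n + x')%N <= xr m' 22])
  => [|i m1|m1 [f [_ [x [xn r39 x22 xmax]]] ->]].
- rewrite /M /= /upd /= r41 !(envE e) addn0; split=> //.
  by exists 0%N; rewrite addn0 /head.
- rewrite (envE eM) => iN f [r38 [x [xn r39 x22 xmax]]]; have e1 := env_cframe eM f isT.
  have headE id : xm m1 (rrow 12) (nm m1 (nrow 8) id) = head m id.
    by rewrite (keepXM 12 eM f isT) (keepNM 8 eM f isT).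
  unroll; rewrite /= /upd /= !(envE e1) r38 headE.
  case: ifP => [le|/negbT] /=.
    split; first by rewrite r38 !(envE e1) addn1 addnS.
    exists x; split=> // x'; rewrite ltnS leq_eqVlt => /orP [/eqP ->//|]; exact: xmax.
  rewrite -ltNge => lt; split; first by rewrite r38 !(envE e1) addn1 addnS.
  exists i; rewrite addn0 addr0; split=> // x'.
  rewrite ltnS leq_eqVlt => /orP [/eqP ->//|/xmax h]; exact: le_trans h (ltW lt).
rewrite (envE eM) in xmax.
have e1 := env_cframe eM f isT.
have r40' : nr m1 40 = a by rewrite (keepN 40 f isT) /M /= /upd /=.
have h12 c : xm m1 (rrow 12) c = xm m (rrow 12) c by rewrite (keepXM 12 eM f isT).
have h14 c : xm m1 (rrow 14) c = xm m (rrow 14) c by rewrite (keepXM 14 eM f isT).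
have h8 c : nm m1 (nrow 8) c = nm m (nrow 8) c by rewrite (keepNM 8 eM f isT).
have h10 c : nm m1 (nrow 10) c = nm m (nrow 10) c by rewrite (keepNM 10 eM f isT).
set m' := exec_op _ _.
have r12 : (rrow 12 == rrow 14) = false by rewrite /rrow; lia.
have r8 : (nrow 8 == nrow 10) = false by rewrite /nrow /=; lia.
have head' id : head m' id = head m id.
  by rewrite /head /m' /= /upd /= /upd2 !(envE e1) r12 r8 /= h12 h8.
have gx a' : nm m' (nrow 10) a' = if a' == a then nr m1 39 else nm m (nrow 10) a'.
  by rewrite /m' /= /upd /= /upd2 !(envE e1) r40' eqxx /= h10.
have gm a' : xm m' (rrow 14) a' = if a' == a then xr m1 22 else xm m (rrow 14) a'.
  by rewrite /m' /= /upd /= /upd2 !(envE e1) r40' eqxx /= h14.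
split.
  by exists x; rewrite gx gm eqxx !head'; split=> // x' x'n; rewrite head'; apply: xmax.
move=> a' ne [x' [h1 h2 h3 h4]]; exists x'; rewrite gx gm (negbTE ne) head'; split=> // y yn.
by rewrite head'; apply: h4.
Qed.

Hypothesis alpha01 : 0 <= alpha <= 1.
Hypothesis n_gt0 : (0 < n)%N.

Definition value (k : nat) (s : seq nat) : R :=
  alpha * maxcost s + (1 - alpha) * cost p d w s k.

Definition best_ok (m : store) : Prop :=
  nr m 45 = 0%N \/
  [/\ nr m 45 = 1%N, (nr m 46 < K)%N, 0 <= xr m 27, attainable (nr m 46) (xr m 27) (xr m 28) &
      xr m 26 = alpha * xr m 27 + (1 - alpha) * xr m 28].

Definition bounded (m : store) (v : R) : Prop := nr m 45 = 1%N /\ xr m 26 <= v.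

Definition pointers (k : nat) (m : store) : Prop :=
  forall a x, (a < n)%N -> (x < n)%N -> exists len q, [/\ entry k m a x len,
    nm m (nrow 8) (a * n + x)%N = ((a * n + x) * n + q)%N, (q <= len)%N &
    forall i, (i < q)%N -> xm m (rrow 13) ((a * n + x) * n + i)%N <= xr m 12].

Definition lawler_ok (m : store) : Prop := 0 <= xr m 12 /\
  exists U z, chain predT U z n /\ forall j, (j < n)%N -> maxlate (z j) (U j) <= xr m 12.

(** Progress measure: the number of constraints passed so far, over all chains. *)
Definition advances (m : store) : nat :=
  \sum_(0 <= a < n) \sum_(0 <= x < n) (nm m (nrow 8) (a * n + x) - (a * n + x) * n)%N.

(** A schedule not yet matched by the candidate certifies two things: V is still a lower bound on
    its F-cost, and all [it] iterations so far advanced a pointer. *)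
Definition sweeping (k it : nat) (m : store) : Prop :=
  [/\ pointers k m, forall a, (a < n)%N -> grouped m a, lawler_ok m, best_ok m &
    forall s, feasible n prec s -> bounded m (value k s) \/
      (xr m 12 <= maxcost s /\ (it <= advances m)%N)].

Lemma pointers_ext k (m m' : store) :
  (forall z, nm m' (nrow 8) z = nm m (nrow 8) z) ->
  (forall z, nm m' (nrow 9) z = nm m (nrow 9) z) ->
  (forall z, xm m' (rrow 12) z = xm m (rrow 12) z) ->
  (forall z, xm m' (rrow 13) z = xm m (rrow 13) z) ->
  xr m' 12 = xr m 12 -> pointers k m -> pointers k m'.
Proof.
move=> h8 h9 h12 h13 hV h a x an xn; have [len [q [ent ptr ql tV]]] := h a x an xn.
exists len, q; split=> //.
- by apply: entry_ext ent => // c _.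
- by rewrite h8.
- by move=> i iq; rewrite h13 hV; apply: tV.
Qed.

Lemma grouped_ext a (m m' : store) :
  (forall z, nm m' (nrow 8) z = nm m (nrow 8) z) ->
  (forall z, nm m' (nrow 10) z = nm m (nrow 10) z) ->
  (forall z, xm m' (rrow 12) z = xm m (rrow 12) z) ->
  (forall z, xm m' (rrow 14) z = xm m (rrow 14) z) ->
  grouped m a -> grouped m' a.
Proof.
move=> h8 h10 h12 h14 [x [xn gx gm hx]].
by exists x; rewrite /head h8 h10 h12 h14; split=> // x' x'n; rewrite h8 h12; apply: hx.
Qed.

(** Each of the [n * n] pointers has moved by at most [len <= n - 1] columns. *)
Lemma advances_lt k m : pointers k m -> (advances m < n * n * n)%N.
Proof.
move=> h; apply: (@leq_ltn_trans (\sum_(0 <= a < n) \sum_(0 <= x < n) n.-1)%N).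
  rewrite /advances !big_mkord; apply: leq_sum => a _.
  rewrite !big_mkord; apply: leq_sum => x _.
  have [len [q [[_ lenn _] -> ql _]]] := h a x (ltn_ord a) (ltn_ord x).
  rewrite addKn; lia.
rewrite !sum_nat_const_nat !subn0; nia.
Qed.

Lemma PickGroup_spec m : env m ->
  let m' := sem PickGroup m in
  [/\ (nr m' 40 < n)%N, nr m' 41 = (nr m' 40 * n)%N, xr m' 23 = xm m (rrow 14) (nr m' 40) &
    forall a, (a < n)%N -> xm m (rrow 14) a <= xr m' 23].
Proof.
move=> e /=; rewrite /PickGroup; unroll; set M := exec_op (NConst 36 0) _.
have eM : env M by rewrite /M; do 4 apply: env_exec => //.
for_inv (fun i (m' : store) => nr m' 36 = (i * n)%N /\
  [/\ (nr m' 40 < n)%N, nr m' 41 = (nr m' 40 * n)%N, xr m' 23 = xm m (rrow 14) (nr m' 40) &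
    forall a, (a < i)%N -> xm m (rrow 14) a <= xr m' 23])
  => [|i m1|m1 [f [_ [h1 h2 h3 h4]] ->]].
- by rewrite /M /= /upd /= !(envE e).
- rewrite (envE eM) => iN f [h0 [h1 h2 h3 h4]]; have e1 := env_cframe eM f isT.
  have gmE : xm m1 (rrow 14) i = xm m (rrow 14) i by rewrite (keepXM 14 eM f isT).
  unroll; rewrite /= /upd /= !(envE e1) gmE; case: ifP => [le|/negbT] /=.
    rewrite h0 !(envE e1) mulSn addnC; split=> //; split=> // a.
    by rewrite ltnS leq_eqVlt => /orP [/eqP ->//|]; apply: h4.
  rewrite -ltNge => lt; rewrite h0 !(envE e1) mulSn addnC; split=> //.
  rewrite !addn0 addr0; split=> // a.
  by rewrite ltnS leq_eqVlt => /orP [/eqP ->//|/h4 h]; apply: le_trans h (ltW lt).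
- by rewrite /= /upd /=; split=> //; rewrite (envE eM) in h4.
Qed.

Lemma RecordBest_spec m k : env m -> pivot m k -> 0 <= xr m 12 ->
  attainable k (xr m 12) (xr m 23) -> best_ok m ->
  let m' := sem RecordBest m in
  [/\ best_ok m', bounded m' (alpha * xr m 12 + (1 - alpha) * xr m 23) &
    forall v, bounded m v -> bounded m' v].
Proof.
move=> e [r28 _ _ kK] V0 att bm /=; rewrite /RecordBest /UpdateBest; unroll.
rewrite /bounded /best_ok /= /upd /= !(envE e) !addr0 !addn0 r28.
case: bm => [h45|[h45 h46 h27 hatt hbest]]; rewrite h45 /=.
  by split; [right | rewrite lexx | move=> v []].
case: ifP => [le|/negbT] /=; first by rewrite h45; split=> //; right.
rewrite -ltNge => lt; split; [by right | by rewrite lexx |].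
by move=> v [_ h]; split=> //; apply: ltW (lt_le_trans lt h).
Qed.

Lemma Advance_spec m k : env m -> pivot m k -> pointers k m ->
  (forall a, (a < n)%N -> grouped m a) -> lawler_ok m ->
  (nr m 40 < n)%N -> nr m 41 = (nr m 40 * n)%N -> xr m 23 = xm m (rrow 14) (nr m 40) ->
  let m' := sem Advance m in
  [/\ pointers k m', forall a, (a < n)%N -> grouped m' a, lawler_ok m' &
    forall s, feasible n prec s -> xr m 12 <= maxcost s -> cost p d w s k < xr m 23 ->
      xr m' 12 <= maxcost s /\ advances m' = (advances m).+1].
Proof.
move=> e pk ptrs grp law a_n r41 x23 /=; rewrite /Advance; unroll.
set a := nr m 40 in a_n r41 x23 *.
have kK : (k < K)%N by case: pk.
have [x [xn gx gm _]] := grp a a_n; set id := (a * n + x)%N in gx gm *.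
have [len [q [ent ptr ql tV]]] := ptrs a x a_n xn; rewrite -/id in ptr tV.
have [endE lenn tab] := ent; rewrite -/id in endE tab.
set M := exec_op (NLoad 37 9 34) _.
have eM : env M by rewrite /M; do 3 apply: env_exec => //.
have [r34 r33 r37] : [/\ nr M 34 = id, nr M 33 = (id * n + q)%N & nr M 37 = (id * n + len)%N].
  by rewrite /M /= /upd /= !(envE e) gx ptr endE.
have [nmM xmM xrM] : [/\ nm M = nm m, xm M = xm m & xr M = xr m] by [].
have [r40M r41M] : nr M 40 = a /\ nr M 41 = (a * n)%N by [].
clearbody M; rewrite /eval_test r33 r37 ltn_add2l.
have GE : xr m 23 = xm m (rrow 12) (id * n + q)%N by rewrite x23 gm /head ptr.
case: ltnP => [qlen|lenq]; last first.
  (* At the end of a chain the bound [l len] holds for every schedule, so none has a pivot cost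
     below [X23] and the progress claim is void. *)
  have qE : q = len by lia.
  split.
  - by apply: pointers_ext ptrs => [z|z|z|z|]; rewrite /= ?nmM ?xmM ?xrM.
  - by move=> a' /grp; apply: grouped_ext => z; rewrite /= ?nmM ?xmM.
  - by rewrite /lawler_ok /= xrM.
  move=> s fs _; rewrite GE qE => lt.
  by have := table_valid_last data_ge0 kK fs tab; rewrite leNgt lt.
set t := xm m (rrow 13) (id * n + q)%N.
set M1 := if _ then _ else _.
have xM1 : xr M1 12 = Num.max (xr m 12) t.
  rewrite /M1 /= r33 /upd /= !(envE eM) xmM xrM -/t; case: ifP => [h|/negbT] /=; first by rewrite max_l.
  by rewrite -ltNge addr0 => /ltW h; rewrite max_r.
have eM1 : env M1.
  by rewrite /M1; case: ifP => _; do 2 apply: env_exec => //.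
have [nmE xmE] : nm M1 = nm m /\ xm M1 = xm m by rewrite /M1 -nmM -xmM; case: ifP.
have nrE y : y != 49 -> nr M1 y = nr M y.
  by rewrite /M1; case: ifP => _ //= /negbTE; rewrite /upd => ->.
clearbody M1.
set M2 := exec_op (NStore 8 34 33) _.
have eM2 : env M2 by rewrite /M2; do 2 apply: env_exec => //.
have r40 : nr M2 40 = a by rewrite /M2 /= /upd /= nrE.
have r41' : nr M2 41 = (a * n)%N by rewrite /M2 /= /upd /= nrE.
have h8 z : nm M2 (nrow 8) z = if z == id then (id * n + q).+1 else nm m (nrow 8) z.
  by rewrite /M2 /= /upd /= /upd2 !(envE eM1) !nrE // r34 r33 eqxx nmE addn1.
have h9 z : nm M2 (nrow 9) z = nm m (nrow 9) z.
  rewrite /M2 /= /upd2 /upd /= !(envE eM1) nmE.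
  by have -> : (nrow 9 == nrow 8) = false by rewrite /nrow /=; lia.
have h10 z : nm M2 (nrow 10) z = nm m (nrow 10) z.
  rewrite /M2 /= /upd2 /upd /= !(envE eM1) nmE.
  by have -> : (nrow 10 == nrow 8) = false by rewrite /nrow /=; lia.
have xmM2 : xm M2 = xm m by rewrite /M2 /= xmE.
have xM2 : xr M2 12 = Num.max (xr m 12) t by rewrite /M2 /= xM1.
have [ga gother] := Regroup_spec eM2 n_gt0 r40 r41'.
have f3 := @sem_frame R Regroup M2 isT; have e3 := env_cframe eM2 f3 isT.
set m' := sem Regroup M2 in ga gother f3 e3 *.
have V' : xr m' 12 = Num.max (xr m 12) t by rewrite (keepX 12 f3 isT).
have h8' z : nm m' (nrow 8) z = if z == id then (id * n + q).+1 else nm m (nrow 8) z.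
  by rewrite (keepNM 8 eM2 f3 isT) h8.
have h9' z : nm m' (nrow 9) z = nm m (nrow 9) z by rewrite (keepNM 9 eM2 f3 isT) h9.
have h12' z : xm m' (rrow 12) z = xm m (rrow 12) z by rewrite (keepXM 12 eM2 f3 isT) xmM2.
have h13' z : xm m' (rrow 13) z = xm m (rrow 13) z by rewrite (keepXM 13 eM2 f3 isT) xmM2.
split.
- move=> a' x' a'n x'n; have [len' [q' [ent' ptr' ql' tV']]] := ptrs a' x' a'n x'n.
  have ent2 : entry k m' a' x' len' by apply: entry_ext ent' => // c _.
  case: (a' * n + x' =P id)%N => [idE|ne].
    have [ea ex] := pair_id_inj x'n xn idE; subst a' x'.
    exists len, q.+1; split=> //; first by apply: entry_ext ent => // c _.
      by rewrite h8' eqxx addnS.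
    move=> i; rewrite ltnS leq_eqVlt V' h13' le_max => /orP [/eqP ->|iq]; first by rewrite lexx orbT.
    by rewrite tV.
  exists len', q'; split=> //; first by rewrite h8'; case: eqP.
  by move=> i iq; rewrite V' h13' le_max tV'.
- move=> a' a'n; case: (a' =P a) => [->|/eqP ne]; first exact: ga.
  apply: gother => //; have [x' [x'n gx' gm' mx']] := grp a' a'n.
  have h8x y : (y < n)%N -> head M2 (a' * n + y)%N = head m (a' * n + y)%N.
    move=> yn; rewrite /head xmM2 h8; case: eqP => // /(pair_id_inj yn xn) [ea _].
    by rewrite ea eqxx in ne.
  exists x'; rewrite h10 xmM2 h8x //; split=> // y yn; rewrite h8x //; exact: mx'.
- case: law => V0 [U [z [ch hV]]]; rewrite /lawler_ok V'; split; first by rewrite le_max V0.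
  by exists U, z; split=> // j jn; rewrite le_max hV.
move=> s fs Vs lt.
(* A pivot cost below [l] leaves only the other alternative, which justifies raising V to [t]. *)
have [tle|] := table_valid data_ge0 kK fs tab qlen; last by rewrite -GE leNgt lt.
split; first by rewrite V' ge_max Vs.
rewrite /advances.
pose F := fun a' x' => (nm m (nrow 8) (a' * n + x') - (a' * n + x') * n)%N.
(* Exactly one summand, that of [(a, x)], has grown by 1. *)
transitivity (\sum_(0 <= a' < n) \sum_(0 <= x' < n) (F a' x' + ((a' == a) && (x' == x))))%N.
  apply: eq_big_nat => a' a'n; apply: eq_big_nat => x' x'n; rewrite /F h8'.
  case: (a' * n + x' =P id)%N => [idE|ne].
    have [-> ->] := pair_id_inj x'n xn idE; rewrite !eqxx ptr; lia.
  by case: (a' =P a) => [ea|_]; case: (x' =P x) => [ex|_] //=; rewrite ?addn0 //; case: ne; rewrite ea ex.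
under eq_bigr => a' _ do rewrite big_split /=.
rewrite big_split /= -addn1; congr (_ + _)%N.
rewrite (bigD1_seq a) ?iota_uniq ?mem_index_iota //= eqxx /=.
rewrite (bigD1_seq x) ?iota_uniq ?mem_index_iota //= eqxx /=.
rewrite [X in (_ + X + _)%N]big1 ?addn0; last by move=> y /negbTE ->.
by rewrite [X in (_ + X)%N]big1 // => y /negbTE ->; rewrite big1.
Qed.

Lemma value_le k s (V g : R) : V <= maxcost s -> g <= cost p d w s k ->
  alpha * V + (1 - alpha) * g <= value k s.
Proof.
move=> hV hg; case/andP: alpha01 => a0 a1.
by rewrite lerD // ler_wpM2l // subr_ge0.
Qed.

Lemma Sweep_step k it m : env m -> pivot m k -> sweeping k it m ->
  let m' := sem (PickGroup ;; RecordBest ;; Advance) m in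
  sweeping k it.+1 m' /\ forall v, bounded m v -> bounded m' v.
Proof.
move=> e pk [ptrs grp law best prog] /=; unroll.
have kK : (k < K)%N by case: pk.
have [a_n r41 x23 amax] := PickGroup_spec e.
have f1 := @sem_frame R PickGroup m isT; have e1 := env_cframe e f1 isT.
set m1 := sem PickGroup m in a_n r41 x23 amax f1 e1 *.
have V1 : xr m1 12 = xr m 12 by rewrite (keepX 12 f1 isT).
have law1 : lawler_ok m1 by rewrite /lawler_ok V1.
have best1 : best_ok m1.
  rewrite /best_ok (keepN 45 f1 isT) (keepN 46 f1 isT).
  by rewrite (keepX 26 f1 isT) (keepX 27 f1 isT) (keepX 28 f1 isT).
have bnd1 v : bounded m v -> bounded m1 v.
  by rewrite /bounded (keepN 45 f1 isT) (keepX 26 f1 isT).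
have ptrs1 : pointers k m1.
  apply: pointers_ext V1 ptrs => z; rewrite ?(keepNM 8 e f1 isT) ?(keepNM 9 e f1 isT) //.
    by rewrite (keepXM 12 e f1 isT).
  by rewrite (keepXM 13 e f1 isT).
have grp1 a : (a < n)%N -> grouped m1 a.
  move=> /grp; apply: grouped_ext => z; rewrite ?(keepNM 8 e f1 isT) ?(keepNM 10 e f1 isT) //.
    by rewrite (keepXM 12 e f1 isT).
  by rewrite (keepXM 14 e f1 isT).
(* [X23] is the largest head over all groups, hence at least the current [l] of every chain. *)
have att : attainable k (xr m1 12) (xr m1 23).
  case: (law1) => _ lchain; apply: (cut_tables_attainable data_ge0 kK lchain) => a x an xn.
  have [len [q [[_ _ tab] ptr ql tV]]] := ptrs1 a x an xn.
  exists len, (fun i => xm m1 (rrow 13) ((a * n + x) * n + i)%N),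
    (fun i => xm m1 (rrow 12) ((a * n + x) * n + i)%N), q; split=> //.
  apply: le_trans (amax a an); rewrite -(keepXM 14 e f1 isT).
  by have [x' [_ _ _ /(_ x xn)]] := grp1 a an; rewrite /head ptr.
have pk1 : pivot m1 k := pivot_cframe pk f1 isT.
have V0 : 0 <= xr m1 12 by case: law1.
have [best2 bnd2 keep2] := RecordBest_spec e1 pk1 V0 att best1.
have f2 := @sem_frame R RecordBest m1 isT; have e2 := env_cframe e1 f2 isT.
set m2 := sem RecordBest m1 in best2 bnd2 keep2 f2 e2 *.
have V2 : xr m2 12 = xr m1 12 by rewrite (keepX 12 f2 isT).
have law2 : lawler_ok m2 by rewrite /lawler_ok V2.
have ptrs2 : pointers k m2.
  apply: pointers_ext V2 ptrs1 => z; rewrite ?(keepNM 8 e1 f2 isT) ?(keepNM 9 e1 f2 isT) //.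
    by rewrite (keepXM 12 e1 f2 isT).
  by rewrite (keepXM 13 e1 f2 isT).
have grp2 a : (a < n)%N -> grouped m2 a.
  move=> /grp1; apply: grouped_ext => z; rewrite ?(keepNM 8 e1 f2 isT) ?(keepNM 10 e1 f2 isT) //.
    by rewrite (keepXM 12 e1 f2 isT).
  by rewrite (keepXM 14 e1 f2 isT).
have pk2 : pivot m2 k := pivot_cframe pk1 f2 isT.
have r40 : nr m2 40 = nr m1 40 by rewrite (keepN 40 f2 isT).
have [||| ptrs3 grp3 law3 adv] := Advance_spec e2 pk2 ptrs2 grp2 law2.
- by rewrite r40.
- by rewrite r40 (keepN 41 f2 isT).
- by rewrite r40 (keepX 23 f2 isT) x23 (keepXM 14 e1 f2 isT) (keepXM 14 e f1 isT).
have f3 := @sem_frame R Advance m2 isT; have e3 := env_cframe e2 f3 isT.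
set m3 := sem Advance m2 in ptrs3 grp3 law3 adv f3 e3 *.
have bnd3 v : bounded m2 v -> bounded m3 v.
  by rewrite /bounded (keepN 45 f3 isT) (keepX 26 f3 isT).
split; last by move=> v /bnd1 /keep2 /bnd3.
split=> //.
  rewrite /best_ok (keepN 45 f3 isT) (keepN 46 f3 isT).
  by rewrite (keepX 26 f3 isT) (keepX 27 f3 isT) (keepX 28 f3 isT).
move=> s fs; case: (prog s fs) => [/bnd1 /keep2 /bnd3 h|[Vs itle]]; first by left.
(* Either the pair just recorded is no worse than [s], or [s] forces the advance. *)
have [lt|ge] := ltP (cost p d w s k) (xr m1 23); last first.
  left; apply: bnd3; case: bnd2 => h1 h2; split=> //; apply: le_trans h2 _.
  by apply: value_le; rewrite ?V1.
right; have [||V3 adv3] := adv s fs; first by rewrite V2 V1.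
  by rewrite (keepX 23 f2 isT).
split=> //; rewrite adv3 ltnS; apply: leq_trans itle _.
rewrite leq_eqVlt; apply/orP; left; apply/eqP.
apply: eq_bigr => a _; apply: eq_bigr => x _.
by rewrite (keepNM 8 e1 f2 isT) (keepNM 8 e f1 isT).
Qed.

Lemma AllGroups_spec m : env m -> forall a, (a < n)%N -> grouped (sem AllGroups m) a.
Proof.
move=> e; rewrite /AllGroups sem_seq sem_op; set M := exec_op _ m.
have eM : env M by rewrite /M; apply: env_exec => //.
for_inv (fun i (m' : store) => nr m' 41 = (i * n)%N /\ forall a, (a < i)%N -> grouped m' a)
  => [//|a m1|m1 [f1 [_ grp1] ->]]; last by move: grp1; rewrite (envE eM).
rewrite (envE eM) => an f [r41 grp]; have e1 := env_cframe eM f isT.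
unroll; set m2 := setN 40 a m1; have e2 : env m2 by apply: env_setN.
have [ga gother] := Regroup_spec e2 n_gt0 (erefl : nr m2 40 = a) r41.
have f3 := @sem_frame R Regroup m2 isT; have e3 := env_cframe e2 f3 isT.
split; first by rewrite /= /upd /= (keepN 41 f3 isT) /= /upd /= r41 !(envE e3) mulSn addnC.
move=> a'; rewrite ltnS leq_eqVlt => /orP [/eqP ->//|lt].
by apply: gother; [rewrite neq_ltn lt | exact: (grp a' lt)].
Qed.

Lemma Sweep_spec k m : env m -> pivot m k -> lawler_ok m -> best_ok m ->
  (forall s, feasible n prec s -> xr m 12 <= maxcost s) ->
  (forall a x, (a < n)%N -> (x < n)%N ->
    nm m (nrow 8) (a * n + x)%N = ((a * n + x) * n)%N /\ exists len, entry k m a x len) ->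
  let m' := sem Sweep m in
  [/\ best_ok m', forall s, feasible n prec s -> bounded m' (value k s) &
    forall v, bounded m v -> bounded m' v].
Proof.
move=> e pk law best Vopt tabs /=; rewrite /Sweep sem_seq.
have grp1 := AllGroups_spec e.
have f1 := @sem_frame R AllGroups m isT; have e1 := env_cframe e f1 isT.
set m1 := sem AllGroups m in grp1 f1 e1 *.
have ptrs0 : pointers k m.
  move=> a x an xn; have [ptr [len ent]] := tabs a x an xn.
  by exists len, 0%N; rewrite addn0.
pose inv it (m' : store) := sweeping k it m' /\ forall v, bounded m v -> bounded m' v.
have inv0 : inv 0%N m1.
  split; last first.
    by move=> v; rewrite /bounded /= /upd /= (keepN 45 f1 isT) (keepX 26 f1 isT).
  split=> //.
  - apply: (pointers_ext _ _ _ _ _ ptrs0) => [z|z|z|z|] /=.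
    + by rewrite (keepNM 8 e f1 isT).
    + by rewrite (keepNM 9 e f1 isT).
    + by rewrite (keepXM 12 e f1 isT).
    + by rewrite (keepXM 13 e f1 isT).
    + by rewrite (keepX 12 f1 isT).
  - by rewrite /lawler_ok /= (keepX 12 f1 isT).
  - rewrite /best_ok /= /upd /= (keepN 45 f1 isT) (keepN 46 f1 isT).
    by rewrite (keepX 26 f1 isT) (keepX 27 f1 isT) (keepX 28 f1 isT).
  by move=> s fs; right; rewrite /= (keepX 12 f1 isT); split=> //; exact: Vopt.
have pk1 : pivot m1 k := (pivot_cframe pk f1 isT).
for_inv (fun i (m' : store) => inv (i * (n * n))%N m') => [//|i m2|m2 [f2 I2 ->]].
  rewrite (envE e1) => iN f2 I2; have e2 := env_cframe e1 f2 isT.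
  set m2' := setN 42 i m2; have e2' : env m2' by apply: env_setN.
  have pk2 : pivot m2' k := (pivot_cframe pk1 f2 isT).
  for_inv (fun j (m' : store) => inv (i * (n * n) + j * n)%N m') => [|j m3|m3 [f3 I3 ->]].
  - by rewrite addn0.
  - rewrite (envE e2') => jN f3 I3; have e3 := env_cframe e2' f3 isT.
    set m3' := setN 43 j m3; have e3' : env m3' by apply: env_setN.
    have pk3 : pivot m3' k := (pivot_cframe pk2 f3 isT).
    for_inv (fun l (m' : store) => inv (i * (n * n) + j * n + l)%N m') => [|l m4|m4 [f4 I4 ->]].
    + by rewrite addn0.
    + rewrite (envE e3') => lN f4 I4; have e4 := env_cframe e3' f4 isT.
      set m4' := setN 44 l m4; have e4' : env m4' by apply: env_setN.
      have pk4 : pivot m4' k := (pivot_cframe pk3 f4 isT).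
      case: I4 => sw4 bnd4; have sw4' : sweeping k (i * (n * n) + j * n + l)%N m4' := sw4.
      have [sw5 bnd5] := Sweep_step e4' pk4 sw4'.
      by rewrite addnS; split=> // v /bnd4 h; apply: bnd5.
    by move: I4; rewrite (envE e3') mulSn addnCA addnC.
  by move: I3; rewrite (envE e2') mulSn addnC.
move: I2; rewrite (envE e1) => -[[ptrs2 _ _ best2 prog2] bnd2]; split=> // s fs.
(* An uncovered schedule would require [n ^ 3] advances, more than the chains allow. *)
case: (prog2 s fs) => // -[_]; have := advances_lt ptrs2; rewrite mulnA; lia.
Qed.

(** * Reconstruction of a schedule from the best pair *)

Lemma Cap_spec m (U : pred nat) k : env m -> pivot m k -> cur m k = load k U ->
  forall z, (z < n)%N -> inH (sem Cap m) z = (late k z U <= xr m 28).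
Proof.
move=> e pk curE; rewrite /Cap.
for_inv (fun i (m' : store) => forall z, (z < i)%N -> inH m' z = (late k z U <= xr m 28))
  => [//|i m1|m1 [f I ->]]; last by move: I; rewrite (envE e).
rewrite (envE e) => iN f I; have e1 := env_cframe e f isT.
rewrite sem_seq; set m2 := setN 26 i m1; have e2 : env m2 by apply: env_setN.
have pk2 : pivot m2 k := pivot_cframe pk f isT.
have cur2 : cur m2 k = load k U by rewrite -curE /cur (keepXM 11 e f isT).
have lateE := pivot_late e2 pk2 (erefl : nr m2 26 = i) iN cur2.
have f3 := @sem_frame R PivotLate m2 isT; have e3 := env_cframe e2 f3 isT.
set m3 := sem PivotLate m2 in lateE f3 e3 *.
have h7 z : nm m3 (nrow 7) z = nm m1 (nrow 7) z by rewrite (keepNM 7 e2 f3 isT).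
have r26 : nr m3 26 = i by rewrite (keepN 26 f3 isT).
have x28 : xr m3 28 = xr m 28 by rewrite (keepX 28 f3 isT) [LHS](keepX 28 f isT).
rewrite sem_if /= lateE x28 /Mark /Unmark.
case: ifP => h; unroll; move=> z zi; rewrite /inH /= /upd2 !(envE e3) eqxx r26 h7 /=;
  case: (z =P i) => [->|ne]; rewrite ?h // -?(I z) //; lia.
Qed.

Lemma SetPivot_spec m k : env m -> nr m 28 = k -> (k < K)%N -> pivot (sem SetPivot m) k.
Proof.
by move=> e r28 kK; rewrite /SetPivot; unroll; split; rewrite //= /upd /= !(envE e) r28.
Qed.

Lemma nrow_neq0 a : (4 < a)%N -> (nrow a == 0%N) = false.
Proof. by rewrite /nrow => a4; rewrite ifF; apply/negbTE; lia. Qed.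

Lemma sub_succ_neq i j : (j < i)%N -> (i < n)%N -> (n - j.+1 == n - i.+1)%N = false.
Proof. by move=> *; apply/negbTE; lia. Qed.

Lemma Output_spec m : env m -> (nr m 46 < K)%N -> 0 <= xr m 27 ->
  attainable (nr m 46) (xr m 27) (xr m 28) ->
  let s := [seq nm (sem Output m) 0 t | t <- iota 0 n] in
  [/\ feasible n prec s, forall i, (i < K)%N -> cost p d w s i <= xr m 27 &
    cost p d w s (nr m 46) <= xr m 28].
Proof.
move=> e; set k := nr m 46; set V := xr m 27; set g := xr m 28 => kK V0 att s.
have g0 : 0 <= g.
  have [|z [[zn _ _] _ zg]] := att predT; first by exists 0%N.
  exact: le_trans (late_ge0 data_ge0 _ kK zn) zg.
(* [rs] lists the jobs in order of removal; [peel rs j] is what remains after [j] removals. *)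
pose peel (rs : seq nat) (j : nat) : pred nat := fun x => x \notin take j rs.
suff [rs [szrs out h]] : exists rs, [/\ size rs = n,
    forall j, (j < n)%N -> nm (sem Output m) 0 (n - j.+1)%N = nth 0%N rs j &
    forall j, (j < n)%N -> [/\ sink (peel rs j) (nth 0%N rs j),
      maxlate (nth 0%N rs j) (peel rs j) <= V & late k (nth 0%N rs j) (peel rs j) <= g]].
  have sE : s = rev [seq nth 0%N rs j | j <- iota 0 n].
    apply: (@eq_from_nth _ 0%N); first by rewrite size_rev !size_map.
    rewrite size_map size_iota => i iN; rewrite nth_rev size_map size_iota //.
    rewrite !(nth_map 0%N) ?size_iota ?nth_iota; try lia.
    rewrite !add0n -out; last lia.
    by congr (nm _ _ _); lia.
  have [||| fs costs] := @peel_schedule R n K prec p d w (peel rs) (nth 0%N rs).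
  - by move=> j _; rewrite /peel take0.
  - by move=> j /h [].
  - move=> j x jn xn; rewrite /peel (take_nth 0%N) ?szrs //.
    by rewrite mem_rcons inE negb_or andbC.
  rewrite sE; split=> // [i iK|]; apply: costs => // j /h [_ hV hg] //.
  by move: i iK; apply/(maxlate_leP _ _ _ _ _ _ _ V0).
rewrite /Output; unroll; set m0 := exec_op (NAdd 28 46 2) m.
have m0k : nr m0 28 = k by rewrite /m0 /= /upd /= !(envE e) addn0.
have e0 : env m0 by rewrite /m0; apply: env_exec.
have pk1 := SetPivot_spec e0 m0k kK.
have f1 := @sem_frame R SetPivot m0 isT; have e1 := env_cframe e0 f1 isT.
set m1 := sem SetPivot m0 in pk1 f1 e1 *.
have [cm2 U2] := InitSet_spec e1.
have f2 := @sem_frame R InitSet m1 isT; have e2 := env_cframe e1 f2 isT.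
set m2 := sem InitSet m1 in cm2 U2 f2 e2 *.
set M := exec_op (NAdd 47 0 2) m2.
have fM : cframe (NAdd 47 0 2) m2 M := exec_op_frame (NAdd 47 0 2) m2.
have eM := env_cframe e2 fM isT.
have pkM : pivot M k := pivot_cframe pk1 f2 isT.
have xM28 : xr M 28 = g by rewrite (keepX 28 fM isT) (keepX 28 f2 isT) (keepX 28 f1 isT).
for_inv (fun i (m' : store) => exists rs, [/\ size rs = i, nr m' 47 = (n - i)%N,
    forall j, (j < i)%N -> nm m' 0 (n - j.+1)%N = nth 0%N rs j,
    cnt_ok m' /\ (forall j, (j < n)%N -> inU m' j = (j \notin rs)) &
    forall j, (j < i)%N -> [/\ sink (peel rs j) (nth 0%N rs j),
      maxlate (nth 0%N rs j) (peel rs j) <= V & late k (nth 0%N rs j) (peel rs j) <= g]])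
  => [|i m3|m3 [f [rs]]].
- exists [::]; split=> //; first by rewrite /M /= /upd /= !(envE e2) addn0 subn0.
- rewrite (envE eM) => iN f [rs [szrs r47 out [cm3 U3] good]]; have e3 := env_cframe eM f isT.
  unroll; set m4 := setN 27 i m3; have e4 : env m4 by apply: env_setN.
  have cur5 i' : (i' < K)%N -> cur (sem Loads m4) i' = load i' (inU m4).
    by move=> i'K; exact: (Loads_spec e4).
  have f5 := @sem_frame R Loads m4 isT; have e5 := env_cframe e4 f5 isT.
  set m5 := sem Loads m4 in cur5 f5 e5 *.
  have pk5 : pivot m5 k := pivot_cframe (pivot_cframe pkM f isT : pivot m4 k) f5 isT.
  have capE := Cap_spec e5 pk5 (cur5 k kK).
  have f6 := @sem_frame R Cap m5 isT; have e6 := env_cframe e5 f6 isT.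
  set m6 := sem Cap m5 in capE f6 e6 *.
  have x28 : xr m5 28 = g by rewrite (keepX 28 f5 isT) [LHS](keepX 28 f isT).
  have U6 j : inU m6 j = inU m3 j.
    by rewrite /inU (keepNM 6 e5 f6 isT) (keepNM 6 e4 f5 isT).
  have cm6 : cnt_ok m6.
    move=> j jn; rewrite (eq_bigl (inU m3)) // -cm3 //.
    by rewrite (keepNM 5 e5 f6 isT) (keepNM 5 e4 f5 isT).
  have cur6 i' : (i' < K)%N -> cur m6 i' = load i' (inU m6).
    move=> i'K; rewrite /cur (keepXM 11 e5 f6 isT) [LHS]cur5 //.
    by apply: eq_load => j _; rewrite U6.
  have sel := Select_spec e6 cm6 cur6.
  have f7 := @sem_frame R Select m6 isT; have e7 := env_cframe e6 f7 isT.
  set m7 := sem Select m6 in sel f7 e7 *.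
  have lateE z : late k z (inU m6) = late k z (inU m4).
    by apply: eq_late => j _; rewrite U6.
  have inh : inhabited n (inU m6).
    have [/hasP [j]|/hasPn noj] := boolP (has (inU m6) (iota 0 n)).
      by rewrite mem_iota => jn Uj; exists j.
    have : (size (iota 0 n) <= size rs)%N.
      apply: uniq_leq_size; first exact: iota_uniq.
      move=> j jn; have := noj j jn; rewrite U6 U3 ?negbK //.
      by move: jn; rewrite mem_iota.
    by rewrite size_iota szrs leqNgt iN.
  (* Attainability offers [y0]; the selected [y] is also allowed by [g] and has no larger
     [maxlate]. *)
  have [y0 [sy0 y0V y0g]] := att _ inh.
  have y0n : (y0 < n)%N by case: sy0.
  have Hy0 : inH m6 y0 by rewrite capE // -lateE x28.
  case: sel => [[_ nosink]|[_ [y [r25 sy Hy _ ymin]]]].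
    by have := nosink y0 y0n sy0; rewrite Hy0.
  have [yn Uy _] := sy.
  have yV : maxlate y (inU m6) <= V by apply: le_trans y0V; exact: ymin.
  have yg : late k y (inU m6) <= g by move: Hy; rewrite capE // -lateE x28.
  have U7 j : inU m7 j = inU m6 j by rewrite /inU (keepNM 6 e6 f7 isT).
  have cm7 : cnt_ok m7.
    move=> j jn; rewrite (eq_bigl (inU m6)) // -cm6 //.
    by rewrite (keepNM 5 e6 f7 isT).
  have [|cm8 U8] := Remove_spec e7 cm7 r25 yn; first by rewrite U7.
  have f8 := @sem_frame R Remove m7 isT; have e8 := env_cframe e7 f8 isT.
  set m8 := sem Remove m7 in cm8 U8 f8 e8 *.
  set m9 := exec_op (NStore 2 47 25) _.
  have r47' : nr m8 47 = (n - i)%N.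
    by rewrite (keepN 47 f8 isT) (keepN 47 f7 isT) (keepN 47 f6 isT) (keepN 47 f5 isT).
  have r25' : nr m8 25 = y by rewrite (keepN 25 f8 isT).
  have nm9 r c : nm m9 r c = if (r == 0%N) && (c == n - i.+1)%N then y else nm m8 r c.
    by rewrite /m9 /= /upd /= /upd2 r47' r25' !(envE e8) -subnDA addn1.
  have row0 c : nm m8 0 c = nm m3 0 c.
    have := keepNM 2 (z := c) e7 f8 isT; rewrite {1 2}/nrow /= => ->.
    have := keepNM 2 (z := c) e6 f7 isT; rewrite {1 2}/nrow /= => ->.
    have := keepNM 2 (z := c) e5 f6 isT; rewrite {1 2}/nrow /= => ->.
    by have := keepNM 2 (z := c) e4 f5 isT; rewrite {1 2}/nrow /= => ->.
  have U9 j : inU m9 j = inU m3 j && (j != y).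
    by rewrite /inU nm9 nrow_neq0 //= -/(inU m8 j) U8 U7 U6.
  have takeE j : (j <= i)%N -> take j (rcons rs y) = take j rs.
    by move=> ji; rewrite -cats1 takel_cat // szrs.
  exists (rcons rs y); split.
  + by rewrite size_rcons szrs.
  + by rewrite /m9 /= /upd /= r47' !(envE e8) -subnDA addn1.
  + move=> j; rewrite ltnS leq_eqVlt nm9 /= nth_rcons szrs => /orP [/eqP ->|ji].
      by rewrite eqxx ltnn eqxx.
    by rewrite ji sub_succ_neq ?row0 ?out.
  + split=> [j jn|j jn]; last by rewrite U9 U3 // mem_rcons inE negb_or andbC.
    rewrite nm9 nrow_neq0 //= cm8 //; apply: eq_bigl => x.
    by rewrite U9 U8 U7 U6.
  move=> j; rewrite ltnS leq_eqVlt nth_rcons szrs => /orP [/eqP ->|ji].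
    have pE x : (x < n)%N -> inU m6 x = peel (rcons rs y) i x.
      by move=> xn; rewrite U6 U3 // /peel takeE // -szrs take_size.
    rewrite ltnn eqxx; split; first exact: eq_sink sy.
      by rewrite -(eq_maxlate _ _ _ _ _ pE).
    by rewrite -(eq_late _ _ _ _ _ pE).
  have pE x : (x < n)%N -> peel rs j x = peel (rcons rs y) j x.
    by move=> xn; rewrite /peel takeE // ltnW.
  have [h1 h2 h3] := good j ji; rewrite ji; split; first exact: eq_sink h1.
    by rewrite -(eq_maxlate _ _ _ _ _ pE).
  by rewrite -(eq_late _ _ _ _ _ pE).
rewrite (envE eM) => -[szrs _ out _ good] ->.
by exists rs.
Qed.

Lemma Optimize_spec m : env m -> nr m 45 = 0%N ->
  let m' := sem Optimize m in best_ok m' /\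
  forall k s, (k < K)%N -> feasible n prec s -> bounded m' (value k s).
Proof.
move=> e h45 /=; rewrite /Optimize.
for_inv (fun i (m' : store) => best_ok m' /\
    forall k s, (k < i)%N -> feasible n prec s -> bounded m' (value k s))
  => [|k m1|m1 [f [b1 I1] ->]]; last by split=> //; rewrite (envE e) in I1.
  by split=> //; left.
rewrite (envE e) => kK f [b1 I1]; have e1 := env_cframe e f isT.
unroll; set m2 := setN 28 k m1; have e2 : env m2 by apply: env_setN.
have pk3 := SetPivot_spec e2 (erefl : nr m2 28 = k) kK.
have f3 := @sem_frame R SetPivot m2 isT; have e3 := env_cframe e2 f3 isT.
set m3 := sem SetPivot m2 in pk3 f3 e3 *.
have [V0 chn Vopt] := Lawler_spec e3.
have f4 := @sem_frame R Lawler m3 isT; have e4 := env_cframe e3 f4 isT.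
set m4 := sem Lawler m3 in V0 chn Vopt f4 e4 *.
have pk4 : pivot m4 k := pivot_cframe pk3 f4 isT.
have tabs := Tables_spec e4 pk4.
have f5 := @sem_frame R Tables m4 isT; have e5 := env_cframe e4 f5 isT.
set m5 := sem Tables m4 in tabs f5 e5 *.
have pk5 : pivot m5 k := pivot_cframe pk4 f5 isT.
have V5 : xr m5 12 = xr m4 12 by rewrite (keepX 12 f5 isT).
have keep45 : nr m5 45 = nr m1 45.
  by rewrite (keepN 45 f5 isT) (keepN 45 f4 isT) (keepN 45 f3 isT).
have keep46 : nr m5 46 = nr m1 46.
  by rewrite (keepN 46 f5 isT) (keepN 46 f4 isT) (keepN 46 f3 isT).
have keep26 : xr m5 26 = xr m1 26.
  by rewrite (keepX 26 f5 isT) (keepX 26 f4 isT) (keepX 26 f3 isT).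
have keep27 : xr m5 27 = xr m1 27.
  by rewrite (keepX 27 f5 isT) (keepX 27 f4 isT) (keepX 27 f3 isT).
have keep28 : xr m5 28 = xr m1 28.
  by rewrite (keepX 28 f5 isT) (keepX 28 f4 isT) (keepX 28 f3 isT).
have law5 : lawler_ok m5 by rewrite /lawler_ok V5.
have b5 : best_ok m5 by rewrite /best_ok keep45 keep46 keep26 keep27 keep28.
have Vopt5 s : feasible n prec s -> xr m5 12 <= maxcost s by rewrite V5; exact: Vopt.
have [b6 bnd6 keep6] := Sweep_spec e5 pk5 law5 b5 Vopt5 tabs.
split=> // k' s; rewrite ltnS leq_eqVlt => /orP [/eqP ->|lt] fs; first exact: bnd6.
by apply: keep6; rewrite /bounded keep45 keep26; exact: I1.
Qed.

Lemma feasible_exists m : env m -> exists s, feasible n prec s.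
Proof.
move=> e; have [_ [U [z [[U0 zs _ US] _]]] _] := Lawler_spec e.
have [fs _] := @peel_schedule R n K prec p d w U z U0 (fun m h => (zs m h).1) US.
by exists (rev [seq z j | j <- iota 0 n]).
Qed.

(** Replacing the minimum over scenarios by the cost under any one [k] only overestimates the
    objective, so the pivot need not be the cheapest scenario of [s]. *)
Lemma hurwicz_le s k (V g : R) : (k < K)%N -> 0 <= V ->
  (forall i, (i < K)%N -> cost p d w s i <= V) -> cost p d w s k <= g ->
  hurwicz K alpha p d w s <= alpha * V + (1 - alpha) * g.
Proof.
move=> kK V0 hV hg; case/andP: alpha01 => a0 a1.
rewrite /hurwicz lerD // ler_wpM2l ?subr_ge0 //.
  by apply: bigmax_seq_le => // i _; exact: hV.
apply: le_trans hg.
by apply: (@bigmin_seq_le _ _ _ (fun i : 'I_K => cost p d w s i) _ (Ordinal kK)); rewrite mem_index_enum.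
Qed.

(** The default of the minimum is the cost under scenario 0, itself one of the values as [K] is
    positive. *)
Lemma hurwicz_value s : (0 < K)%N -> exists2 k, (k < K)%N & value k s = hurwicz K alpha p d w s.
Proof.
move=> K0; rewrite /value /hurwicz.
have -> : maxcost s = \big[Num.max/0]_(i < K) cost p d w s i by rewrite /maxcost big_mkord.
have [->|[i ->]] := bigmin_seq_attained (index_enum 'I_K) (fun i => cost p d w s i) (cost p d w s 0).
  by exists 0%N.
by exists i.
Qed.

Lemma reaches_straight P (l : seq instr) o (m : store) : all straight l -> code_at P o l ->
  reaches P (size l) (at_pc o m) (at_pc (o + size l) (foldl (fun m i => exec_op i m) m l)).
Proof.
elim: l o m => [|i l IHl] o m /=; first by rewrite addn0; exists 0%N.
move=> /andP [si sl]; rewrite -cat1s => /code_at_cat [hi hl].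
rewrite -addSnnS; apply: (@reaches_trans _ _ 1 (size l) _ (at_pc o.+1 (exec_op i m))).
  exact: reaches_step (step_straight m si hi).
by apply: IHl => //; move: hl; rewrite /= addn1.
Qed.

Definition init_store : store :=
  let st := init_state n K prec alpha p d w in
  foldl (fun m i => exec_op i m) (Store (nreg st) (rreg st) (nmem st) (rmem st)) prelude.

Lemma exec_NAdd (m : store) r a b va vb : nr m a = va -> nr m b = vb ->
  exec_op (NAdd r a b) m = setN r (va + vb) m.
Proof. by move=> <- <-. Qed.

Lemma init_storeE :
  let st := init_state n K prec alpha p d w in
  let m0 := Store (nreg st) (rreg st) (nmem st) (rmem st) in
  init_store = exec_op (RConst 2 1)
    (setN 14 (K + K + K + 1 + 1 + 1) (setN 13 (K + K + K + 1 + 1)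
    (setN 12 (K + K + K + 1) (setN 11 (K + K + K)
    (setN 10 (n + 1 + 1 + 1 + 1 + 1 + 1) (setN 9 (n + 1 + 1 + 1 + 1 + 1)
    (setN 8 (n + 1 + 1 + 1 + 1) (setN 7 (n + 1 + 1 + 1) (setN 6 (n + 1 + 1)
    (setN 5 (n + 1) (setN 4 (K + K) (setN 3 1 m0)))))))))))).
Proof.
move=> st m0; rewrite /init_store -/m0; cbv beta iota delta [foldl prelude].
rewrite [exec_op (NConst 3 1) m0]/(setN 3 1 m0).
rewrite (@exec_NAdd _ 4 1 1 K K); [|reflexivity|reflexivity].
rewrite (@exec_NAdd _ 5 0 3 n 1); [|reflexivity|reflexivity].
rewrite (@exec_NAdd _ 6 5 3 (n + 1) 1); [|reflexivity|reflexivity].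
rewrite (@exec_NAdd _ 7 6 3 (n + 1 + 1) 1); [|reflexivity|reflexivity].
rewrite (@exec_NAdd _ 8 7 3 (n + 1 + 1 + 1) 1); [|reflexivity|reflexivity].
rewrite (@exec_NAdd _ 9 8 3 (n + 1 + 1 + 1 + 1) 1); [|reflexivity|reflexivity].
rewrite (@exec_NAdd _ 10 9 3 (n + 1 + 1 + 1 + 1 + 1) 1); [|reflexivity|reflexivity].
rewrite (@exec_NAdd _ 11 4 1 (K + K) K); [|reflexivity|reflexivity].
rewrite (@exec_NAdd _ 12 11 3 (K + K + K) 1); [|reflexivity|reflexivity].
rewrite (@exec_NAdd _ 13 12 3 (K + K + K + 1) 1); [|reflexivity|reflexivity].
rewrite (@exec_NAdd _ 14 13 3 (K + K + K + 1 + 1) 1); [|reflexivity|reflexivity].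
reflexivity.
Qed.

Lemma init_store_env : env init_store /\ nr init_store 45 = 0%N.
Proof.
rewrite init_storeE; split=> //; split; rewrite //= /upd /=.
- lia.
- move=> a; rewrite !inE /nrow.
  by move=> /or4P [|||/or4P []] /eqP -> /=; lia.
- by move=> a; rewrite !inE /rrow => /or4P [] /eqP -> /=; lia.
- by move=> j y jn yn; rewrite jn yn /=; case: (prec j y).
- by move=> i j iK jn; rewrite leqNgt jn iK.
- move=> i j iK jn; rewrite leqNgt jn /= ltnNge leq_addr /= addKn.
  by have -> : (K + i < 2 * K)%N by lia.
- move=> i j iK jn; rewrite leqNgt jn /= addKn.
  have -> : (2 * K + i < K)%N = false by lia.
  have -> : (2 * K + i < 2 * K)%N = false by lia.
  by have -> : (2 * K + i < 3 * K)%N by lia.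
Qed.

End Specs.

Lemma fuel_bound (W S D X : nat) : (D <= W * X -> 1 + (S + D) <= (W + S + 1) * X.+1)%N.
Proof. by move=> h; rewrite mulnS !mulnDl; lia. Qed.

Theorem theorem4 :
  exists (P : seq instr) (c : nat),
  forall (R : realFieldType) (n K : nat) (prec : nat -> nat -> bool)
         (p d w : nat -> nat -> R) (alpha : R),
    (1 < K)%N ->
    strict_partial_order n prec ->
    (forall i j, (i < K)%N -> (j < n)%N ->
       0 <= p i j /\ 0 <= d i j /\ 0 <= w i j) ->
    0 <= alpha <= 1 ->
    exists fin : mstate R,
      run P (c * (K ^ 2 * n ^ 4).+1) (init_state n K prec alpha p d w) = Some fin /\
      let s := output n fin in
      feasible n prec s /\
      (forall s', feasible n prec s' ->
         hurwicz K alpha p d w s <= hurwicz K alpha p d w s').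
Proof.
(* One step for the initial test, the prelude, and the weight of [Main] as factor of
   [K ^ 2 * n ^ 4]. *)
exists program, (weight Main + size prelude + 1)%N.
move=> R n K prec p d w alpha K1 spo data alpha01.
have sP := size_link (compile (size prelude).+1 Main).
have [cj cp cm] := code_at_link (compile (size prelude).+1 Main).
rewrite -/program in sP cj cp cm; move: (program) sP cj cp cm => P sP cj cp cm.
set N := (weight Main + size prelude + 1)%N.
set m0 : store R := let st := init_state n K prec alpha p d w in
  Store (nreg st) (rreg st) (nmem st) (rmem st).
have start : init_state n K prec alpha p d w = at_pc 0 m0 by [].
have finish m t : reaches P t (at_pc 0 m0) (at_pc (size P) m) ->
    (t <= N * (K ^ 2 * n ^ 4).+1)%N ->
    run P (N * (K ^ 2 * n ^ 4).+1) (init_state n K prec alpha p d w) = Some (at_pc (size P) m).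
  move=> [u ut hu] tc; rewrite start -(subnKC (leq_trans ut tc)) hu; exact: run_end.
have evalE : eval_test (TEqN 0 2) m0 = (n == 0%N) by [].
have := reaches_step (step_jump m0 cj); rewrite evalE; have [n0|n_gt0] := posnP n.
  move=> sj; exists (at_pc (size P) m0); split.
    by apply: finish sj _; rewrite muln_gt0 /N addn1.
  have -> : output n (at_pc (size P) m0) = [::] by rewrite n0.
  rewrite n0 /=; split; first by split.
  by move=> s' [pe _]; have -> : s' = [::] by apply/nilP; rewrite /nilp (perm_size pe).
move=> sj.
have K0 : (0 < K)%N by lia.
have [e1 h45] := init_store_env K prec p d w alpha01 n_gt0.
have r1 : reaches P (size prelude) (at_pc 1 m0)
    (at_pc (size prelude).+1 (init_store n K prec p d w alpha)).
  exact: (reaches_straight m0 _ cp).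
set m1 := init_store n K prec p d w alpha in e1 h45 r1.
have dM : disciplined Main by [].
have wM : wf Main by [].
have r2 := compile_correct dM (env_n e1) (env_K e1) (env_1 e1) cm.
have durE := duration_bound n_gt0 K0 wM.
(* A deepest nest: pivots, two job indices of a cut, chain steps, jobs scanned by [Select],
   scenarios in [MaxLate]. *)
have [d0 d1] : depth 0 Main = 4 /\ depth 1 Main = 2 by [].
rewrite d0 d1 [(n ^ 4 * _)%N]mulnC in durE.
have [best6 bnd6] := Optimize_spec spo data alpha01 n_gt0 e1 h45.
have f6 := sem_frame m1 (isT : disciplined Optimize); have e6 := env_cframe e1 f6 isT.
have mainE : sem Main m1 = sem Output (sem Optimize m1) by rewrite /Main sem_seq.
rewrite mainE in r2; set m6 := sem Optimize m1 in best6 bnd6 f6 e6 mainE r2.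
exists (at_pc (size P) (sem Output m6)); split.
  apply: (finish _ (1 + (size prelude + duration n K Main))%N).
    by rewrite sP; apply: reaches_trans sj (reaches_trans r1 r2).
  exact: fuel_bound durE.
(* Some feasible schedule exists, and being covered by the candidate it shows that a candidate was
   recorded. *)
have [s0 fs0] := feasible_exists spo data e1.
have [h45' _] := bnd6 0%N s0 K0 fs0.
case: best6 => [|[_ k6 V0 att valE]]; first by rewrite h45'.
have [fs costs costk] := Output_spec data alpha01 n_gt0 e6 k6 V0 att.
split=> // s' fs'; have [k kK <-] := hurwicz_value p d w alpha s' K0.
apply: le_trans (hurwicz_le alpha01 k6 V0 costs costk) _.
by have [_] := bnd6 k s' kK fs'; rewrite valE.
Qed.
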